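(* Let $R=\overline{\mathbb{Q}}$ and let $\sigma\in\mathrm{Gal}(\overline{\mathbb{Q}}/\mathbb{Q})$. Then $\Theta_{[\psi]}$ is equivariant for the action of the Galois group in the sense that, for all $\pi_1\in\mathrm{Irr}_{\overline{\mathbb{Q}}}(H_1)$, we have $${}^\sigma\Theta_{[\psi]}(\pi_1)\simeq\Theta_{[\psi^\sigma]}({}^\sigma\pi_1).$$
   Context: $F$ is a field of characteristic $\neq2$ that is finite or non-archimedean local, with (residual) cardinality $q=p^f$. $\psi:F\to\overline{\mathbb{Q}}^\times$ is a non-trivial smooth character; $\psi^\sigma=\sigma\circ\psi$; for $a\in F^\times$, $\psi^a(t)=\psi(at)$; $[\psi]$ is the orbit of $\psi$ under $F^{\times2}$. Weil representation. Let $(W,\langle\ ,\ \rangle)$ be a nonzero symplectic $F$-vector space with a complete polarisation $W=X\oplus Y$ (transverse Lagrangians). The Heisenberg group is $H=W\times F$ with law $(w,t)(w',t')=(w+w',t+t'+\frac12\langle w,w'\rangle)$; $\mathrm{Sp}(W)$ acts by $g\cdot(w,t)=(gw,t)$. The Heisenberg representation $\rho_\psi$ is realised on $C_c^\infty(Y,\overline{\mathbb{Q}})$ by $\rho_\psi(x+y,t)f(y')=\psi(t)\psi(\langle y',x\rangle+\frac12\langle y,x\rangle)f(y'+y)$. The metaplectic group $\mathrm{Mp}(W)$ is the non-trivial topological double cover of $\mathrm{Sp}(W)$ if $F$ is local, and $\mathrm{Sp}(W)\times\{\pm1\}$ if $F$ is finite. The Weil representation $\omega_\psi$ is the smooth representation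 of $\mathrm{Mp}(W)$ on $C_c^\infty(Y,\overline{\mathbb{Q}})$ characterised by: the central element $-1$ acts by $-1$; $\omega_\psi(\tilde g)\rho_\psi(h)\omega_\psi(\tilde g)^{-1}=\rho_\psi(g\cdot h)$ for $\tilde g$ above $g$; and $(n,1)$ above $n\in N(X)$ (unipotent radical of the stabiliser of $X$, which lifts to $\mathrm{Mp}(W)$) acts by $f(y)\mapsto\psi(\frac12\langle by,y\rangle)f(y)$ with $b=(n-\mathrm{id}_W)|_Y:Y\to X$. One has $\omega_\psi\simeq\omega_{\psi'}$ if and only if $\psi'\in[\psi]$. Theta lifts. $(H_1,H_2)$ is a reductive dual pair in $\mathrm{Sp}(W)$, or more precisely $H_1,H_2$ denote its lifts (inverse images) in $\mathrm{Mp}(W)$; these commute, and $V=\omega_\psi$ is viewed as a representation of $H_1\times H_2$. $\mathrm{Irr}_R(H_1)$ is the set of isomorphism classes of irreducible smooth $R$-representations of $H_1$ (these are admissible). For $\pi_1\in\mathrm{Irr}_{\overline{\mathbb{Q}}}(H_1)$, the largest $\pi_1$-isotypic quotient of $V$ is $V_{\pi_1}=V/\bigcap_{f\in\mathrm{Hom}_{H_1}(V,\pi_1)}\mathrm{Ker}(f)$, and $\Theta_{[\psi]}(\pi_1)$ is the smooth representation of $H_2$, unique up to isomorphism, with $V_{\pi_1}\simeq\Theta_{[\psi]}(\pi_1)\otimes_{\overline{\mathbb{Q}}}\pi_1$. For a representation $\pi$ over $\overline{\mathbb{Q}}$, ${}^\sigma\pi$ is the representation whose matrix coefficients in a basis are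 obtained by applying $\sigma$ to those of $\pi$ (equivalently, the same group action with scalars acting through $\sigma^{-1}$). *)

(* Defs.v *)
From HB Require Import structures.
From mathcomp Require Import all_boot all_order all_algebra all_field.
From mathcomp Require Import boolp classical_sets functions cardinality topology.
From mathcomp Require Import tvs ring.

Set Implicit Arguments.
Unset Strict Implicit.
Unset Printing Implicit Defensive.

Import Order.TTheory GRing.Theory Num.Theory.
Import VectorInternalTheory.

Local Open Scope classical_set_scope.
Local Open Scope ring_scope.

HB.mixin Record isTopologicalField F & GRing.Field F & TopologicalZmodule F := {
  mulf_continuous : continuous (fun x : F * F => x.1 * x.2);
  invf_continuous : forall x : F, x != 0 -> {for x, continuous (@GRing.inv F)}
}.

#[short(type="topFieldType")]
HB.structure Definition TopologicalField :=
  {F of GRing.Field F & TopologicalZmodule F & isTopologicalField F}.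

HB.mixin Record isTopologicalGroup G & Group G & Topological G := {
  mulg_continuous : continuous (fun x : G * G => (x.1 * x.2)%g);
  invg_continuous : continuous (fun x : G => (x^-1)%g)
}.

#[short(type="topGroupType")]
HB.structure Definition TopologicalGroup :=
  {G of Group G & Topological G & isTopologicalGroup G}.

Section FiniteOrLocal.
Variable F : topFieldType.

Definition finite_field : Prop :=
  finite_set [set: F] /\ forall A : set F, open A.

(* [in_pow v n x]: x lies in the n-th power of the maximal ideal of v; the
   value of [v] at 0 is irrelevant. *)
Definition in_pow (v : F -> int) (n : int) : set F :=
  [set x | x = 0 \/ (n <= v x)%R].

Record discrete_valuation (v : F -> int) : Prop := {
  valM : forall x y, x != 0 -> y != 0 -> v (x * y) = v x + v y;
  valD : forall n x y, in_pow v n x -> in_pow v n y -> in_pow v n (x + y);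
  val_surj : forall n, exists2 x, x != 0 & v x = n }.

(* F carries the topology of a discrete valuation for which it is complete and
   whose residue field is finite. *)
Definition nonarch_local_field : Prop := exists v : F -> int,
  [/\ discrete_valuation v,
      forall (x : F) (A : set F),
        nbhs x A <-> exists n, [set y | in_pow v n (y - x)] `<=` A,
      forall u : nat -> F,
        (forall n, exists N, forall i j, (N <= i)%N -> (N <= j)%N ->
           in_pow v n (u i - u j)) ->
        exists l : F, u @ \oo --> l
    & exists s : seq F, forall x, in_pow v 0 x ->
        exists2 r, r \in s & in_pow v 1 (x - r)].

End FiniteOrLocal.

Definition locally_constant (T : topologicalType) (A : Type) (f : T -> A) : Prop :=
  forall a, open (f @^-1` [set a]).

Record smooth_character (F : topFieldType) := SmoothCharacter {
  schar :> F -> algC;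
  schar0 : schar 0 = 1;
  scharD : forall s t, schar (s + t) = schar s * schar t;
  schar_smooth : locally_constant schar;
  schar_nontrivial : exists t, schar t != 1 }.

Section Characters.
Variable F : topFieldType.
Implicit Types psi : smooth_character F.

Definition char_class psi : set (smooth_character F) :=
  [set psi' | exists2 a : F, a != 0 & forall t, psi' t = psi (a ^+ 2 * t)].

Lemma galois_char_smooth (sigma : {rmorphism algC -> algC}) psi :
  locally_constant (sigma \o psi).
Proof.
move=> a; have := schar_smooth psi (algC_invaut sigma a).
suff -> : psi @^-1` [set algC_invaut sigma a] = (sigma \o psi) @^-1` [set a] by [].
apply/seteqP; split=> t /=; first by move->; rewrite algC_invautK.
by move<-; rewrite algC_autK.
Qed.

Lemma galois_char_nontrivial (sigma : {rmorphism algC -> algC}) psi :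
  exists t, (sigma \o psi) t != 1.
Proof.
have [t psit] := schar_nontrivial psi; exists t => /=.
by rewrite -(rmorph1 sigma) (inj_eq (fmorph_inj sigma)).
Qed.

Lemma galois_char0 (sigma : {rmorphism algC -> algC}) psi :
  (sigma \o psi) 0 = 1.
Proof. by rewrite /= schar0 rmorph1. Qed.

Lemma galois_charD (sigma : {rmorphism algC -> algC}) psi s t :
  (sigma \o psi) (s + t) = (sigma \o psi) s * (sigma \o psi) t.
Proof. by rewrite /= scharD rmorphM. Qed.

Definition galois_char (sigma : {rmorphism algC -> algC}) psi :=
  SmoothCharacter (galois_char0 sigma psi) (galois_charD sigma psi)
    (@galois_char_smooth sigma psi) (galois_char_nontrivial sigma psi).

End Characters.

Definition vtop (F : topFieldType) (V : vectType F) : Type :=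
  initial_topology (v2r : V -> 'rV[F]_(dim V)).

HB.instance Definition _ (F : topFieldType) (V : vectType F) :=
  Vector.copy (vtop V) V.
HB.instance Definition _ (F : topFieldType) (V : vectType F) :=
  Topological.copy (vtop V)
    (initial_topology (v2r : V -> 'rV[F]_(dim V))).

Section VectorTopology.
Variables (F : topFieldType) (V : vectType F).

Lemma vtop_translation_continuous (a : V) :
  continuous (fun y : vtop V => (y + a : vtop V)).
Proof.
apply/continuousP => _ [B Bopen <-]; rewrite openE => y /= By.
have /= := @initial_continuous V _ (v2r : V -> 'rV[F]_(dim V)) y.
have nB : nbhs (v2r (y + a) : 'rV[F]_(dim V)) B by exact: open_nbhs_nbhs.
case: nB => P nP PB cv.
pose Q i j := (fun t : F => t + v2r a i j) @^-1` P i j.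
have tC (c : F) : continuous (fun t : F => t + c).
  move=> t; apply: (@continuous2_cvg _ _ _ _ _ _ _ _ (fun x y : F => x + y));
    last exact: cvg_cst; last exact: cvg_id.
  exact: (@add_continuous F (t, c)).
have nQ : nbhs (v2r y : 'rV[F]_(dim V)) [set M | forall i j, Q i j (M i j)].
  exists Q => // i j; apply: (tC (v2r a i j) (v2r y i j) (P i j)).
  by have := nP i j; rewrite linearD mxE.
apply: (@filterS _ (nbhs y) _ _ _ _ (cv _ nQ)) => z /= Qz.
by apply: PB => i j; rewrite linearD mxE; exact: Qz.
Qed.

Lemma vtop_scalar_continuous (f : {scalar V}) :
  continuous (f : vtop V -> F).
Proof.
have fE y : f y = \sum_i v2r y 0 i * f (r2v (delta_mx 0 i)).
  rewrite -{1}[y]v2rK {1}[v2r y]row_sum_delta !linear_sum; apply: eq_bigr => i _.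
  by rewrite !linearZ.
have coordC i : continuous (fun y : vtop V => v2r y 0 i : F).
  move=> y A nA.
  apply: (@initial_continuous V _ (v2r : V -> 'rV[F]_(dim V)) y
    [set M : 'rV[F]_(dim V) | A (M 0 i)]).
  exists (fun k l => if l == i then A else setT) => [k l|M /(_ 0 i)]; last first.
    by rewrite eqxx.
  by rewrite ord1; case: eqP => [->|_] //; exact: filterT.
have -> : (f : vtop V -> F) =
    (fun y => \sum_i v2r y 0 i * f (r2v (delta_mx 0 i))) by apply/funext.
apply: continuous_big => [|i _ y]; first exact: (@add_continuous F).
apply: (@continuous2_cvg _ F F F (nbhs y) _ (fun y : vtop V => v2r y 0 i)
    (fun _ => f (r2v (delta_mx 0 i))) (fun x y : F => x * y));
  last exact: cvg_cst; last exact: (coordC i y).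
exact: (@mulf_continuous F (_, _)).
Qed.

End VectorTopology.

Lemma locally_constant_op2 (T : topologicalType) (A B C : Type)
    (f : T -> A) (g : T -> B) (op : A -> B -> C) :
  locally_constant f -> locally_constant g ->
  locally_constant (fun y => op (f y) (g y)).
Proof.
move=> fT gT c.
suff -> : (fun y => op (f y) (g y)) @^-1` [set c] =
    \bigcup_(ab in [set ab | op ab.1 ab.2 = c])
      (f @^-1` [set ab.1] `&` g @^-1` [set ab.2]).
  by apply: bigcup_open => ab _; exact: openI.
apply/seteqP; split=> y /=; first by move=> <-; exists (f y, g y).
by case=> -[a b] /= <- [<- <-].
Qed.

Lemma locally_constant_comp (T U : topologicalType) (A : Type)
    (f : T -> U) (g : U -> A) :
  continuous f -> locally_constant g -> locally_constant (g \o f).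
Proof. by move=> /continuousP fC gU a; rewrite comp_preimage; exact: fC. Qed.

Lemma locally_constant_cst (T : topologicalType) (A : Type) (a : A) :
  locally_constant (fun _ : T => a).
Proof.
move=> b; have [->|ab] := pselect (a = b).
  by rewrite preimage_cst mem_set//; exact: openT.
by rewrite preimage_cst memNset//; exact: open0.
Qed.

Section CompactSupport.
Variable T : topologicalType.

Definition fsupport (f : T -> algC) : set T := closure [set y | f y != 0].

Definition ccinf_pred : {pred T -> algC^o} :=
  fun f => `[< locally_constant f /\ compact (fsupport f) >].

Lemma ccinfP (f : T -> algC^o) :
  reflect (locally_constant f /\ compact (fsupport f)) (f \in ccinf_pred).
Proof. exact: asboolP. Qed.

Lemma fsupport_compact (f g : T -> algC) :
  (forall y, g y = 0 -> f y = 0) -> compact (fsupport g) -> compact (fsupport f).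
Proof.
move=> fg gK; apply: (subclosed_compact _ gK); first exact: closed_closure.
by apply: closureS => y /=; apply: contra_neq; exact: fg.
Qed.

Lemma ccinf_submod_closed : submod_closed ccinf_pred.
Proof.
split=> [|a f g /ccinfP[fT fK] /ccinfP[gT gK]]; apply/ccinfP.
  split; first exact: locally_constant_cst.
  suff -> : fsupport 0 = set0 by exact: compact0.
  rewrite /fsupport -[RHS]closure0; congr closure.
  by apply/seteqP; split=> y //=; rewrite eqxx.
split; first exact: (locally_constant_op2 (fun s t => a *: s + t) fT gT).
apply: (subclosed_compact _ (compactU fK gK)); first exact: closed_closure.
rewrite /fsupport -closureU; apply: closureS => y /=; rewrite !fctE.
have [->|] := eqVneq (f y) 0; last by left.
by rewrite scaler0 add0r; right.
Qed.

HB.instance Definition _ :=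
  GRing.isSubmodClosed.Build algC (T -> algC^o) ccinf_pred ccinf_submod_closed.

Record ccinf := CcInf { ccinf_fun :> T -> algC^o; _ : ccinf_fun \in ccinf_pred }.

HB.instance Definition _ := [isSub for ccinf_fun].
HB.instance Definition _ := [Choice of ccinf by <:].
HB.instance Definition _ := [SubChoice_isSubLmodule of ccinf by <:].

End CompactSupport.

Section Symplectic.
Variables (F : topFieldType) (W : vectType F) (form : {skew_symmetric W}).

Definition polarisation (X Y : {vspace W}) : Prop :=
  [/\ orthov form X = X, orthov form Y = Y, (X + Y)%VS = fullv
    & (X :&: Y)%VS = 0%VS].

Definition Sp : set 'End(W) :=
  [set g | forall v w, form (g v) (g w) = form v w].

(* The unipotent radical of the stabiliser of a Lagrangian X consists of the
   symplectic maps acting trivially on X and on W / X. *)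
Definition siegel_radical (X : {vspace W}) : set 'End(W) :=
  [set n | [/\ Sp n, forall x, x \in X -> n x = x
             & forall w, n w - w \in X]].

Definition heis_mul (h h' : W * F) : W * F :=
  (h.1 + h'.1, h.2 + h'.2 + 2%:R^-1 * form h.1 h'.1).

Definition heis_act (g : 'End(W)) (h : W * F) : W * F := (g h.1, h.2).

Variables (X Y : {vspace W}) (psi : smooth_character F).

Local Notation YT := (vtop (subvs_of Y)).

Definition pol_fst (w : W) : W := daddv_pi X Y w.
Definition pol_snd (w : W) : subvs_of Y := vsproj Y (daddv_pi Y X w).

Definition heis_fun (h : W * F) (f : YT -> algC^o) (y' : YT) : algC^o :=
  let x := pol_fst h.1 in let y := pol_snd h.1 in
  psi h.2 * psi (form (vsval y') x + 2%:R^-1 * form (vsval y) x) * f (y' + y).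

Lemma heis_fun_ccinf h (f : ccinf YT) : heis_fun h f \in @ccinf_pred YT.
Proof.
have /ccinfP[fT fK] := valP f; set y := pol_snd h.1.
have yC (z : subvs_of Y) : continuous (fun y' : YT => (y' + z : YT)).
  exact: (@vtop_translation_continuous F (subvs_of Y) z).
apply/ccinfP; split.
  apply: locally_constant_op2; last first.
    exact: (locally_constant_comp (yC y) fT).
  pose x := pol_fst h.1; pose c := 2%:R^-1 * form (vsval y) x.
  apply: (@locally_constant_comp YT F _ (fun y' => form (vsval y') x + c)
    (fun s => psi h.2 * psi s)).
    move=> y'; apply: (@continuous2_cvg _ F F F (nbhs y') _
      (fun y' : YT => form (vsval y') x) (fun=> c) (fun s t : F => s + t)).
    - exact: (@add_continuous F (_, _)).
    - exact: (@vtop_scalar_continuous F (subvs_of Y)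
        (applyr form x \o vsval : {scalar subvs_of Y}) y').
    - exact: cvg_cst.
  apply: locally_constant_op2; first exact: locally_constant_cst.
  exact: schar_smooth.
have yT : compact ((fun y' : YT => y' + y) @^-1` fsupport f).
  have -> : (fun y' : YT => y' + y) @^-1` fsupport f =
      (fun y' : YT => y' - y) @` fsupport f.
    apply/seteqP; split=> z /=; first by exists (z + y); rewrite ?addrK.
    by case=> z' fz' <-; rewrite subrK.
  apply: continuous_compact fK.
  by apply: continuous_subspaceT; exact: yC.
apply: (subclosed_compact _ yT); first exact: closed_closure.
have /closure_id -> : closed ((fun y' : YT => y' + y) @^-1` fsupport f).
  have /continuous_closedP := yC y; apply; exact: closed_closure.
apply: closureS => z /= nz; apply: subset_closure => /=.
by apply: contra_neq nz; rewrite /heis_fun => ->; rewrite mulr0.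
Qed.

Definition heis_rep (h : W * F) (f : ccinf YT) : ccinf YT :=
  CcInf (heis_fun_ccinf h f).


Hypothesis two_neq0 : 2%:R != 0 :> F.
Hypothesis polXY : polarisation X Y.

Lemma heis_repM h h' f : heis_rep (heis_mul h h') f = heis_rep h (heis_rep h' f).
Proof.
have [XX YY XYW XY0] := polXY.
have fstP w : pol_fst w \in X by exact: memv_pi.
have decomp w : w = pol_fst w + vsval (pol_snd w).
  by rewrite /pol_snd vsprojK ?memv_pi// daddv_pi_add// XYW memvf.
have orthoX w w' : form (pol_fst w) (pol_fst w') = 0.
  by have /mem_orthovP : pol_fst w \in orthov form X; [rewrite XX|apply].
have orthoY (y y' : subvs_of Y) : form (vsval y) (vsval y') = 0.
  have /mem_orthovP : vsval y \in orthov form Y by rewrite YY subvsP.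
  by apply; exact: subvsP.
case: h h' => [w t] [w' t']; apply/val_inj/funext => y' /=.
rewrite /heis_fun /=.
have -> : pol_fst (w + w') = pol_fst w + pol_fst w' by rewrite /pol_fst linearD.
have -> : pol_snd (w + w') = pol_snd w + pol_snd w' by rewrite /pol_snd !linearD.
have -> : form w w' = form (vsval (pol_snd w)) (pol_fst w')
    - form (vsval (pol_snd w')) (pol_fst w).
  rewrite [in LHS](decomp w) [in LHS](decomp w') linearDr !linearDl.
  rewrite /= orthoX orthoY.
  rewrite add0r addr0 [form (pol_fst w) _]hermC /= expr1 mulN1r addrC //.
move: (pol_fst w) (pol_fst w') (pol_snd w) (pol_snd w') orthoX => x x' y1 y1' _.
rewrite [y' + (y1 + y1')]addrA !mulrA; congr (_ * _).
rewrite -!scharD [vsval (y1 + y1')]linearD !linearDr !linearDl /=.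
by congr (psi _); field.
Qed.

End Symplectic.

Section Metaplectic.
Variables (F : topFieldType) (W : vectType F) (form : {skew_symmetric W}).
Variables (Mp : topGroupType) (p : Mp -> 'End(W)).

Local Notation ET := (vtop 'End(W)).

Definition double_cover : Prop :=
  [/\ hausdorff_space Mp,
      (forall g h, p (g * h)%g = (p g \o p h)%VF) /\ range p = Sp form,
      continuous (p : Mp -> ET),
      forall U : set Mp, open U -> open (p @` U : set (subspace (Sp form : set ET)))
    & exists2 e : Mp, e != 1%g & [set g | p g = \1%VF] = [set 1%g; e] ].

(* A continuous homomorphic section s makes the cover trivial: the product
   s(g) z, for g in Sp(W) and z in the kernel, identifies Mp with the direct
   product of Sp(W) and the kernel. *)
Definition trivial_cover : Prop := exists s : ET -> Mp,
  [/\ forall g, Sp form g -> p (s g) = g,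
      forall g h, Sp form g -> Sp form h -> s (g \o h)%VF = (s g * s h)%g
    & {within (Sp form : set ET), continuous s} ].

Definition metaplectic_cover : Prop :=
  [/\ double_cover, finite_field F -> trivial_cover
    & nonarch_local_field F -> ~ trivial_cover].

End Metaplectic.

Section Representations.
Variable G : topGroupType.
Implicit Types H K : set G.

Definition is_subgroup H : Prop :=
  [/\ H 1%g, forall g h, H g -> H h -> H (g * h)%g & forall g, H g -> H (g^-1)%g].

(* As for MathComp's morphisms, a representation of a subgroup H of G is a
   function on all of G whose values outside H are irrelevant. *)
Definition is_rep H (V : lmodType algC) (act : G -> V -> V) : Prop :=
  [/\ forall g, H g -> linear (act g),
      forall v, act 1%g v = v
    & forall g h v, H g -> H h -> act (g * h)%g v = act g (act h v)].

Record rep H := Rep {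
  rep_space :> lmodType algC;
  rep_act : G -> rep_space -> rep_space;
  repP : is_rep H rep_act }.

Definition smooth_rep H (V : lmodType algC) (act : G -> V -> V) : Prop :=
  forall v, open ([set h | H h /\ act h v = v] : set (subspace H)).

Definition finite_dim (V : lmodType algC) (U : set V) : Prop :=
  exists n (e : 'I_n -> V), forall v, U v ->
    exists c : 'I_n -> algC, v = \sum_i c i *: e i.

(* K ranges over the open subgroups of H; for locally profinite H this amounts
   to letting K range over the compact open ones. *)
Definition admissible H (pi : rep H) : Prop :=
  smooth_rep H (@rep_act H pi) /\
  forall K, is_subgroup K -> K `<=` H -> open (K : set (subspace H)) ->
    finite_dim [set v : pi | forall k, K k -> rep_act k v = v].

Definition irreducible H (pi : rep H) : Prop :=
  (exists v : pi, v != 0) /\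
  forall U : set pi, U 0 -> (forall a u v, U u -> U v -> U (a *: u + v)) ->
    (forall h v, H h -> U v -> U (rep_act h v)) ->
    U = [set 0] \/ U = setT.

Definition intertwines H (U V : lmodType algC) (actU : G -> U -> U)
    (actV : G -> V -> V) (f : U -> V) : Prop :=
  forall h u, H h -> f (actU h u) = actV h (f u).

Definition rep_iso H (pi rho : rep H) : Prop :=
  exists f : {linear pi -> rho},
    bijective f /\ intertwines H (@rep_act H pi) (@rep_act H rho) f.

End Representations.

(* V with scalars acting through the inverse of sigma. *)
Definition galois_space (sigma : {rmorphism algC -> algC}) (V : lmodType algC)
  : Type := V.

Section GaloisSpace.
Variables (sigma : {rmorphism algC -> algC}) (V : lmodType algC).

HB.instance Definition _ := GRing.Zmodule.copy (galois_space sigma V) V.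

Definition galois_scale (a : algC) (v : galois_space sigma V)
  : galois_space sigma V := algC_invaut sigma a *: (v : V).

Fact galois_scaleA a b v :
  galois_scale a (galois_scale b v) = galois_scale (a * b) v.
Proof. by rewrite /galois_scale scalerA rmorphM. Qed.

Fact galois_scale1 : left_id 1 galois_scale.
Proof. by move=> v; rewrite /galois_scale rmorph1 scale1r. Qed.

Fact galois_scaleDr : right_distributive galois_scale +%R.
Proof. by move=> a u v; rewrite /galois_scale scalerDr. Qed.

Fact galois_scaleDl v : {morph galois_scale^~ v : a b / a + b}.
Proof. by move=> a b; rewrite /galois_scale rmorphD scalerDl. Qed.

HB.instance Definition _ := GRing.Zmodule_isLmodule.Build algC
  (galois_space sigma V) galois_scaleA galois_scale1 galois_scaleDr galois_scaleDl.

End GaloisSpace.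

Section GaloisRep.
Variables (sigma : {rmorphism algC -> algC}) (G : topGroupType) (H : set G).
Variable pi : rep H.

Definition galois_act (g : G) (v : galois_space sigma pi) : galois_space sigma pi :=
  rep_act g (v : pi).

Lemma galois_repP : is_rep H galois_act.
Proof.
have [lin act1 actM] := repP pi; split=> [g Hg a u v||] //.
exact: (lin g Hg (algC_invaut sigma a) u v).
Qed.

Definition galois_rep : rep H := Rep galois_repP.

End GaloisRep.

Section Theta.
Variables (F : topFieldType) (W : vectType F) (form : {skew_symmetric W}).
Variables (X Y : {vspace W}) (Mp : topGroupType) (p : Mp -> 'End(W)).

Local Notation V := (ccinf (vtop (subvs_of Y))).

Record weil_rep (psi : smooth_character F) (omega : Mp -> V -> V) : Prop := {
  weil_is_rep : is_rep setT omega;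
  weil_smooth : smooth_rep setT omega;
  weil_kernel : forall e f, p e = \1%VF -> e != 1%g -> omega e f = - f;
  weil_heis : forall g h f,
    omega g (heis_rep form X psi h (omega (g^-1)%g f)) =
    heis_rep form X psi (heis_act (p g) h) f;
  (* s is the lift of the unipotent radical N(X) to Mp; it is unique since N(X)
     is uniquely 2-divisible. *)
  weil_siegel : exists s : 'End(W) -> Mp,
    [/\ forall n, siegel_radical form X n -> p (s n) = n,
        forall n n', siegel_radical form X n -> siegel_radical form X n' ->
          s (n \o n')%VF = (s n * s n')%g
      & forall n (f : V) y, siegel_radical form X n ->
          omega (s n) f y =
          psi (2%:R^-1 * form (n (vsval y) - vsval y) (vsval y)) * f y] }.

(* G1 and G2 are each other's centraliser in Sp(W) and both act reductively,
   i.e. semisimply, on W. *)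
Definition centraliser (G : set 'End(W)) : set 'End(W) :=
  [set g | Sp form g /\ forall h, G h -> (g \o h)%VF = (h \o g)%VF].

Definition acts_semisimply (G : set 'End(W)) : Prop :=
  forall U : {vspace W}, (forall g, G g -> (g @: U <= U)%VS) ->
    exists U' : {vspace W},
      [/\ forall g, G g -> (g @: U' <= U')%VS, (U + U')%VS = fullv
        & (U :&: U')%VS = 0%VS].

Definition reductive_dual_pair (G1 G2 : set 'End(W)) : Prop :=
  [/\ centraliser G1 = G2, centraliser G2 = G1,
      acts_semisimply G1 & acts_semisimply G2].

(* The universal property that characterises T = U1 (x) U2. *)
Definition is_tensor_product (U1 U2 T : lmodType algC)
    (tau : {bilinear U1 -> U2 -> T}) : Prop :=
  forall (Z : lmodType algC) (beta : {bilinear U1 -> U2 -> Z}),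
    exists2 f : {linear T -> Z}, (forall u1 u2, f (tau u1 u2) = beta u1 u2)
      & forall g : {linear T -> Z},
          (forall u1 u2, g (tau u1 u2) = beta u1 u2) -> g =1 f.

Variables (H1 H2 : set Mp).

(* q : V -> Q identifies V / (intersection of the kernels of the H1-maps from
   omega to pi1) with Q; act1 and act2 are the induced actions of H1 and H2,
   meaningful on H1 and H2 only. *)
Definition largest_isotypic_quotient (omega : Mp -> V -> V) (pi1 : rep H1)
    (Q : lmodType algC) (act1 act2 : Mp -> Q -> Q) (q : {linear V -> Q}) : Prop :=
  [/\ range q = setT,
      forall f, q f = 0 <-> (forall phi : {linear V -> pi1},
        intertwines H1 omega (@rep_act Mp H1 pi1) phi -> phi f = 0),
      intertwines H1 omega act1 q
    & intertwines H2 omega act2 q].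

(* Theta (x) pi1 is the largest pi1-isotypic quotient of the Weil representation
   of some character in the class c. *)
Definition is_theta_lift (c : set (smooth_character F)) (pi1 : rep H1)
    (Theta : rep H2) : Prop :=
  smooth_rep H2 (@rep_act Mp H2 Theta) /\
  exists psi omega, [/\ c psi, weil_rep psi omega
    & exists (Q : lmodType algC) (act1 act2 : Mp -> Q -> Q) (q : {linear V -> Q})
        (tau : {bilinear Theta -> pi1 -> Q}),
      [/\ largest_isotypic_quotient omega pi1 act1 act2 q,
          is_tensor_product tau,
          forall h1 t x, H1 h1 -> tau t (rep_act h1 x) = act1 h1 (tau t x)
        & forall h2 t x, H2 h2 -> tau (rep_act h2 t) x = act2 h2 (tau t x)]].

End Theta.

(* Main.v *)
Require Import Defs.
From HB Require Import structures.
From mathcomp Require Import all_boot all_order all_algebra all_field.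
From mathcomp Require Import boolp classical_sets functions cardinality topology.
From mathcomp Require Import zify ring.

(* If psi0 = psi (a^2 .) and psi0' = sigma psi (b^2 .), put c = b / a. Then
   f |-> sigma o f o (c .) is a sigma-semilinear bijection of C_c^oo(Y) that
   carries the Weil representation of psi0 to a Weil representation of psi0'.
   The latter is unique: two of them differ by scalars, because the Heisenberg
   representation has only scalar endomorphisms, and these scalars are trivial
   on the kernel of the cover and on N(X), whose conjugates contain all the
   transvections and so generate Sp(W). Hence the largest isotypic quotients
   for pi1 and its Galois twist correspond, and Theta is recovered from
   Theta (x) pi1 because, by Schur's lemma, the H1-maps from pi1 to Theta (x) pi1
   are the x |-> t (x) x. *)

Set Implicit Arguments.
Unset Strict Implicit.
Unset Printing Implicit Defensive.

Import Order.TTheory GRing.Theory Num.Theory.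

Local Open Scope classical_set_scope.
Local Open Scope ring_scope.

(** * Vector spaces and tensor products *)

Lemma linear_exists (K : nzRingType) (U V : lmodType K) (f : U -> V) :
  linear f -> exists g : {linear U -> V}, forall u, g u = f u.
Proof.
move=> fL; pose M := GRing.isLinear.Build K U V *:%R f fL.
by exists (HB.pack_for {linear U -> V} f M).
Qed.

Lemma bilinear_exists (K : nzRingType) (U V W : lmodType K) (f : U -> V -> W) :
  (forall v, linear (f^~ v)) -> (forall u, linear (f u)) ->
  exists g : {bilinear U -> V -> W}, forall u v, g u v = f u v.
Proof.
move=> fl fr.
pose M := bilinear_isBilinear.Build K U V W *:%R *:%R f (fl, fr).
by exists (HB.pack_for {bilinear U -> V -> W} f M).
Qed.

Lemma scale_sub_closed (K : fieldType) (V : lmodType K) (U : set V) :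
  U 0 -> (forall a u v, U u -> U v -> U (a *: u + v)) ->
  (forall u v, U u -> U v -> U (u - v)) /\ (forall a u, U u -> U (a *: u)).
Proof.
move=> U0 UP; split=> [u v Uu Uv|a u Uu].
  by rewrite -[- v]scaleN1r addrC; exact: UP.
by rewrite -[_ *: _]addr0; exact: UP.
Qed.

(** By Zorn, take a subspace [M] maximal among those that contain [U] and avoid [v]. Every x then
    lies in [M + K v], and [l x] is its coordinate along [v]. *)
Lemma functional_exists (K : fieldType) (V : lmodType K) (U : set V) (v : V) :
  U 0 -> (forall a u w, U u -> U w -> U (a *: u + w)) -> ~ U v ->
  exists l : {linear V -> K^o}, (forall u, U u -> l u = 0) /\ l v = 1.
Proof.
move=> U0 UP nUv.
pose good (A : set V) := [/\ U `<=` A, A 0,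
  (forall a u w, A u -> A w -> A (a *: u + w)) & ~ A v].
have goodU : good U by split.
have [|M [Mgood0 Mmax]] := @Zorn_bigcup V (fun A => A = set0 \/ good A).
  move=> C Cgood Ctot.
  have [[A0 CA0 gA0]|noC] := pselect (exists2 A, C A & good A); last first.
    left; apply/seteqP; split=> // x [A CA Ax].
    by case: (Cgood _ CA) => [A0|gA]; [rewrite A0 in Ax|case: noC; exists A].
  right; split.
  - by move=> u Uu; exists A0 => //; case: gA0 => UA _ _ _; exact: UA.
  - by exists A0 => //; case: gA0.
  - move=> a u w [A CA Au] [B CB Bw].
    have [D [CD Du Dw]] : exists D, [/\ C D, D u & D w].
      by case: (Ctot _ _ CA CB) => AB; [exists B|exists A]; split => //; exact: AB.
    exists D => //; case: (Cgood _ CD) => [D0|[_ _ DP _]]; last exact: DP.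
    by rewrite D0 in Du.
  - move=> [A CA Av]; case: (Cgood _ CA) => [e|[_ _ _]]; last exact.
    by rewrite e in Av.
have Mgood : good M.
  case: Mgood0 => // M0; case: (Mmax U); last by right.
  by rewrite M0; split=> // /(_ _ U0).
have [UM M0 MP nMv] := Mgood.
have [MB MZ] := scale_sub_closed M0 MP.
have uniqM x a b : M (x - a *: v) -> M (x - b *: v) -> a = b.
  move=> Ma Mb; apply/eqP; rewrite -subr_eq0; apply/negPn/negP => ab0.
  apply: nMv; rewrite -[v](scalerK ab0); apply: MZ.
  suff -> : (a - b) *: v = (x - b *: v) - (x - a *: v) by exact: MB.
  by rewrite opprB [RHS]addrC addrA subrK scalerBl.
have existM x : exists a, M (x - a *: v).
  apply: contrapT => /forallNP nx.
  (* If x were outside [M + K v], then [M' = M + K x] would still avoid [v], against maximality. *)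
  pose M' : set V := [set y | exists a, M (y - a *: x)].
  have MM' : M `<=` M' by move=> y My; exists 0; rewrite scale0r subr0.
  case: (Mmax M').
    split=> // M'M; apply: (nx 0); rewrite scale0r subr0; apply: M'M.
    by exists 1; rewrite scale1r subrr.
  right; split=> [u /UM /MM' //||a u w [b Mb] [c Mc]|].
  - exact: MM'.
  - exists (a * b + c); rewrite scalerDl -scalerA opprD addrACA -scalerBr.
    exact: MP.
  - move=> [b Mb]; have [b0|b0] := eqVneq b 0.
      by apply: nMv; rewrite -[v]subr0 -[X in _ - X](scale0r x) -b0.
    apply: (nx b^-1); rewrite -[x in x - _](scalerK b0) -scalerBr.
    by apply: (MZ); rewrite -opprB -scaleN1r; exact: MZ.
pose l x := projT1 (cid (existM x)).
have lP x : M (x - l x *: v) by exact: (projT2 (cid (existM x))).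
have [|g gE] := @linear_exists K V K^o l.
  move=> a u w; apply: (uniqM (a *: u + w)); first exact: lP.
  rewrite scalerDl -scalerA opprD addrACA -scalerBr.
  exact: MP.
exists g; split=> [u Uu|]; rewrite gE; apply: uniqM (lP _) _.
  by rewrite scale0r subr0; exact: UM.
by rewrite scale1r subrr.
Qed.

Section TensorProduct.
Variables (U1 U2 T : lmodType algC) (tau : {bilinear U1 -> U2 -> T}).
Hypothesis tauT : is_tensor_product tau.

(** Otherwise some functional kills all pure tensors but not [z], while the uniqueness half of the
    universal property makes it zero. *)
Lemma tensor_span (z : T) :
  exists n (t : 'I_n -> U1) (x : 'I_n -> U2), z = \sum_i tau (t i) (x i).
Proof.
pose S : set T := [set z | exists s : seq (U1 * U2), z = \sum_(p <- s) tau p.1 p.2].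
have S0 : S 0 by exists [::]; rewrite big_nil.
have SP a u w : S u -> S w -> S (a *: u + w).
  move=> [s ->] [s' ->]; exists ([seq (a *: p.1, p.2) | p <- s] ++ s').
  rewrite big_cat big_map scaler_sumr; congr (_ + _); apply: eq_bigr => p _ /=.
  by rewrite linearZl_LR.
have [[s ->]|nSz] := pselect (S z).
  exists (size s), (fun i => (tnth (in_tuple s) i).1), (fun i => (tnth (in_tuple s) i).2).
  by rewrite big_tnth.
have [l [lS lz]] := functional_exists S0 SP nSz.
have [b0 b0E] := @bilinear_exists _ U1 U2 algC^o (fun _ _ => 0)
  (fun v a x y => esym (etrans (congr1 (+%R^~ 0) (scaler0 _ a)) (addr0 _)))
  (fun v a x y => esym (etrans (congr1 (+%R^~ 0) (scaler0 _ a)) (addr0 _))).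
have [f _ fu] := tauT b0.
have [n0 n0E] := @linear_exists _ T algC^o (fun _ => 0)
  (fun a x y => esym (etrans (congr1 (+%R^~ 0) (scaler0 _ a)) (addr0 _))).
have lf : l =1 f.
  by apply: fu => u1 u2; rewrite b0E lS//; exists [:: (u1, u2)]; rewrite big_seq1.
have nf : n0 =1 f by apply: fu => u1 u2; rewrite b0E n0E.
by move: lz; rewrite lf -nf n0E => /esym/eqP; rewrite oner_eq0.
Qed.

Lemma tensor_contractl (l : {linear U1 -> algC^o}) :
  exists c : {linear T -> U2}, forall t x, c (tau t x) = l t *: x.
Proof.
have [| |b bE] := @bilinear_exists _ U1 U2 U2 (fun t x => l t *: x).
- by move=> v a x y; rewrite linearP scalerDl scalerA.
- by move=> u a x y; rewrite scalerDr !scalerA mulrC.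
have [c cE _] := tauT b.
by exists c => t x; rewrite cE bE.
Qed.

Lemma tensor_contractr (m : {linear U2 -> algC^o}) :
  exists c : {linear T -> U1}, forall t x, c (tau t x) = m x *: t.
Proof.
have [| |b bE] := @bilinear_exists _ U1 U2 U1 (fun t x => m x *: t).
- by move=> v a x y; rewrite scalerDr !scalerA mulrC.
- by move=> u a x y; rewrite linearP scalerDl scalerA.
have [c cE _] := tauT b.
by exists c => t x; rewrite cE bE.
Qed.

(** Contractions in the first factor separate points. Induction on the number of terms: if the first
    [t] is a combination of the others, its term is absorbed by them; if not, a functional that is 1
    on it and 0 on the others shows that its partner [x ord0] is 0. *)
Lemma tensor_eq0 (z : T) :
  (forall (l : {linear U1 -> algC^o}) (c : {linear T -> U2}),
     (forall t x, c (tau t x) = l t *: x) -> c z = 0) -> z = 0.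
Proof.
have [n [t [x ->]]] := tensor_span z.
elim: n t x => [|n IHn] t x z0; first by rewrite big_ord0.
pose S : set U1 := [set w | exists a : 'I_n -> algC,
  w = \sum_i a i *: t (lift ord0 i)].
have S0 : S 0 by exists (fun=> 0); rewrite big1// => i _; rewrite scale0r.
have SP a u w : S u -> S w -> S (a *: u + w).
  move=> [b ->] [c ->]; exists (fun i => a * b i + c i).
  rewrite scaler_sumr -big_split; apply: eq_bigr => i _ /=.
  by rewrite scalerDl scalerA.
have [[a ta]|nSt] := pselect (S (t ord0)).
  have eqz : \sum_i tau (t i) (x i) =
      \sum_i tau (t (lift ord0 i)) (x (lift ord0 i) + a i *: x ord0).
    rewrite big_ord_recl ta linear_sumlz addrC -big_split; apply: eq_bigr => i _.
    by rewrite /= linearDr linearZr_LR linearZl_LR.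
  by rewrite eqz; apply: IHn => l c cE; rewrite -eqz; exact: z0 cE.
have [l [lS lt]] := functional_exists S0 SP nSt.
have [c cE] := tensor_contractl l.
have lt0 i : l (t (lift ord0 i)) = 0.
  apply: lS; exists (fun j => (j == i)%:R); rewrite (bigD1 i)//= eqxx scale1r.
  by rewrite big1 ?addr0// => j /negPf ->; rewrite scale0r.
have x0 : x ord0 = 0.
  have := z0 _ _ cE; rewrite linear_sum big_ord_recl cE lt scale1r big1 ?addr0//.
  by move=> i _; rewrite cE lt0 scale0r.
rewrite big_ord_recl x0 linear0r add0r; apply: IHn => l' c' c'E.
by have := z0 _ _ c'E; rewrite big_ord_recl x0 linear0r add0r.
Qed.

End TensorProduct.

(** * Schur's lemma and isotypic representations *)

(** The first n+1 iterates of [v] lie in the span of n vectors, hence [p(A) v = 0] for some nonzero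
    polynomial [p]. It splits into linear factors, and one of these kills a nonzero vector. *)
Lemma eigenvector_exists (K : closedFieldType) (V : lmodType K)
    (A : {linear V -> V}) (v : V) n (e : 'I_n -> V) :
  v != 0 -> (forall k, exists c : 'I_n -> K, iter k A v = \sum_i c i *: e i) ->
  exists r (w : V), w != 0 /\ A w = r *: w.
Proof.
move=> v0 /choice[c cE].
(* [ev p w] is [p(A) w]; [evE] allows any bound on the degree. *)
pose ev (p : {poly K}) w := \sum_(k < size p) p`_k *: iter k A w.
have evE N (p : {poly K}) w : (size p <= N)%N -> ev p w = \sum_(k < N) p`_k *: iter k A w.
  move=> pN; rewrite /ev (big_ord_widen N (fun k => p`_k *: iter k A w) pN).
  rewrite big_mkcond; apply: eq_bigr => k _; case: ltnP => // kp.
  by rewrite nth_default// scale0r.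
have iterL k a x y : iter k A (a *: x + y) = a *: iter k A x + iter k A y.
  by elim: k => //= k ->; rewrite linearP.
have evZ a (p : {poly K}) w : ev (a *: p) w = a *: ev p w.
  rewrite (evE (size p)) ?size_scale_leq// scaler_sumr; apply: eq_bigr => k _.
  by rewrite coefZ scalerA.
have evM (p : {poly K}) z w : ev (('X - z%:P) * p) w = ev p (A w - z *: w).
  rewrite (evE (size p).+1); last first.
    by rewrite (leq_trans (size_polyMleq _ _))// size_XsubC.
  under eq_bigr => k _ do rewrite mulrBl coefB coefXM coefCM scalerBl.
  rewrite big_split/= big_ord_recl eqxx scale0r add0r.
  rewrite big_ord_recr /= nth_default// mulr0 scale0r subr0 -big_split /ev.
  apply: eq_bigr => k _ /=.
  suff -> : iter k A (A w - z *: w) = A (iter k A w) - z *: iter k A w.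
    by rewrite scalerBr scalerA mulrC.
  by rewrite addrC -scaleNr iterL -iterS iterSr scaleNr addrC.
suff [p p0 evp] : exists2 p : {poly K}, p != 0 & ev p v = 0.
  have [s ps] := closed_field_poly_normal p.
  have {}evp : ev (\prod_(z <- s) ('X - z%:P)) v = 0.
    have := evp; rewrite [in X in ev X]ps evZ => /eqP.
    by rewrite scaler_eq0 lead_coef_eq0 (negPf p0) => /eqP.
  (* Either [v] is an eigenvector for [z], or [A v - z *: v] is a nonzero vector killed by the
     remaining factors. *)
  elim: s v v0 evp {p p0 ps c cE} => [|z s IHs] v v0.
    rewrite big_nil /ev size_poly1 big_ord1 coef1 scale1r /= => v00.
    by rewrite v00 eqxx in v0.
  rewrite big_cons evM; have [/subr0_eq Az _|Az] := eqVneq (A v - z *: v) 0;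
    last exact: IHs.
  by exists z, v.
(* The rows are the coordinates of the iterates. There is one more row than columns, so the left
   kernel contains a nonzero row, which gives the coefficients of [p]. *)
pose M := \matrix_(k < n.+1, i < n) c k i.
have : kermx M != 0.
  rewrite -mxrank_eq0 mxrank_ker subn_eq0 -ltnNge ltnS; exact: rank_leq_col.
move=> kM; pose u := nz_row (kermx M).
have u0 : u != 0 by rewrite nz_row_eq0.
have uM : u *m M = 0 by apply/sub_kermxP; exact: nz_row_sub.
exists (rVpoly u).
  by apply: contra_neq u0 => u0; rewrite -[u]rVpolyK u0 linear0.
rewrite (evE n.+1) ?size_poly//.
under eq_bigr => k _ do rewrite coef_rVpoly_ord cE scaler_sumr.
rewrite exchange_big big1// => i _ /=.
under eq_bigr => k _ do rewrite scalerA.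
rewrite -scaler_suml; have /matrixP/(_ 0 i) := uM; rewrite !mxE => uMi.
suff -> : \sum_k u 0 k * c k i = 0 by rewrite scale0r.
by rewrite -[RHS]uMi; apply: eq_bigr => k _; rewrite mxE.
Qed.

Section RepresentationTheory.
Variable G : topGroupType.

(** By smoothness the stabiliser [K] of a nonzero [v] is open, so by admissibility its fixed vectors
    lie in a finite-dimensional space. [A] preserves them and so has an eigenvector; the eigenspace
    is a nonzero subrepresentation, hence everything. *)
Lemma schur (H : set G) (pi : rep H) (A : {linear pi -> pi}) :
  is_subgroup H -> irreducible pi -> admissible pi ->
  intertwines H (@rep_act G H pi) (@rep_act G H pi) A ->
  exists r : algC, forall v, A v = r *: v.
Proof.
move=> [H1 HM HV] [[v v0] irr] [sm adm] AH.
have [lin act1 actM] := repP pi.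
pose K : set G := [set h | H h /\ rep_act h v = v].
have Ksub : is_subgroup K.
  split=> [|g h [Hg gv] [Hh hv]|g [Hg gv]]; split=> //.
  - exact: HM.
  - by rewrite actM// hv gv.
  - exact: HV.
  - by rewrite -{1}gv -actM ?mulVg ?act1//; exact: HV.
have [|n [e eE]] := adm K Ksub _ (sm v); first by move=> h [].
have [k|r [w [w0 Aw]]] := @eigenvector_exists _ pi A v n e v0.
  apply: eE => h; elim: k => /= [|k IHk] [Hh hv] //.
  by rewrite -AH// IHk.
exists r.
have [| | |U0|UT] := irr [set u | A u = r *: u].
- by rewrite /= linear0 scaler0.
- move=> a x y /= Ax Ay; rewrite linearP Ax Ay scalerDr !scalerA; congr (_ *: _ + _).
  exact: mulrC.
- move=> h x Hh /= Ax; rewrite AH// Ax.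
  have [g gE] := linear_exists (lin h Hh).
  by rewrite -!gE linearZ.
- by have : [set 0] w; [rewrite -U0|move=> w00; rewrite w00 eqxx in w0].
- by move=> u; have : [set u | A u = r *: u] u by rewrite UT.
Qed.

(* With [m x0 = 1], the partner of t in U2 is the contraction of [tau1 t x0]
   against m. *)
Lemma isotypic_factor_unique (H1 H2 : set G) (pi : rep H1) (U1 U2 : rep H2)
    (Q : lmodType algC) (act1 act2 : G -> Q -> Q)
    (tau1 : {bilinear U1 -> pi -> Q}) (tau2 : {bilinear U2 -> pi -> Q}) :
  (exists v : pi, v != 0) ->
  (forall A : {linear pi -> pi},
     intertwines H1 (@rep_act G H1 pi) (@rep_act G H1 pi) A ->
     exists r : algC, forall v, A v = r *: v) ->
  (forall h, H1 h -> linear (act1 h)) ->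
  is_tensor_product tau1 -> is_tensor_product tau2 ->
  (forall h t x, H1 h -> tau1 t (rep_act h x) = act1 h (tau1 t x)) ->
  (forall h t x, H1 h -> tau2 t (rep_act h x) = act1 h (tau2 t x)) ->
  (forall h t x, H2 h -> tau1 (rep_act h t) x = act2 h (tau1 t x)) ->
  (forall h t x, H2 h -> tau2 (rep_act h t) x = act2 h (tau2 t x)) ->
  rep_iso U1 U2.
Proof.
move=> [x0 x00] endo act1L T1 T2 e11 e12 e21 e22.
have [||m [_ mx0]] := @functional_exists _ pi [set 0] x0 erefl.
- by move=> a u w -> ->; rewrite scaler0 addr0.
- by move=> x0E; rewrite /= x0E eqxx in x00.
have factor (V1 V2 : rep H2) (t1 : {bilinear V1 -> pi -> Q})
    (t2 : {bilinear V2 -> pi -> Q}) (c : {linear Q -> V2}) :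
    is_tensor_product t2 -> (forall t x, c (t2 t x) = m x *: t) ->
    (forall h t x, H1 h -> t1 t (rep_act h x) = act1 h (t1 t x)) ->
    (forall h t x, H1 h -> t2 t (rep_act h x) = act1 h (t2 t x)) ->
    forall t x, t1 t x = t2 (c (t1 t x0)) x.
  move=> t2T cE e1 e2 t x; apply/eqP; rewrite -subr_eq0; apply/eqP.
  apply: (tensor_eq0 t2T) => l d dE.
  have dact h z : H1 h -> d (act1 h z) = rep_act h (d z).
    have [lin _ _] := repP pi => Hh.
    have [g gE] := linear_exists (lin h Hh).
    have [n [s [y ->]]] := tensor_span t2T z.
    have [a aE] := linear_exists (act1L h Hh).
    rewrite -aE -gE !linear_sum; apply: eq_bigr => i _.
    by rewrite aE -e2// !dE linearZ /= gE.
  (* Contracting [t1 t x] against [l] leaves an H1-endomorphism of [pi] in x, hence a scalar [r]. *)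
  have [A AE] := @linear_exists _ pi pi (fun y => d (t1 t y))
    (fun a y z => etrans (congr1 d (linearPr t1 t a y z)) (linearP d a _ _)).
  have [r rE] : exists r : algC, forall v, A v = r *: v.
    by apply: endo => h u Hh; rewrite !AE e1// dact.
  (* Both sides contract [z] against [l] and [m]. At [z = t1 t x0] this identifies [r] with
     [l (c (t1 t x0))]. *)
  have mc z : m (d z) = l (c z).
    have [n [s [y ->]]] := tensor_span t2T z.
    rewrite !linear_sum; apply: eq_bigr => i _; rewrite dE cE !linearZ /=.
    exact: mulrC.
  by rewrite linearB dE -mc -!AE !rE [m _]linearZ mx0 -scalerA scale1r subrr.
have [c1 c1E] := tensor_contractr T1 m.
have [c2 c2E] := tensor_contractr T2 m.
have F12 := factor _ _ _ _ _ T2 c2E e11 e12.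
have F21 := factor _ _ _ _ _ T1 c1E e12 e11.
have [f fE] := @linear_exists _ U1 U2 (fun t => c2 (tau1 t x0))
    (fun a y z => etrans (congr1 c2 (linearPl tau1 x0 a y z)) (linearP c2 a _ _)).
exists f; split.
  exists (fun t => c1 (tau2 t x0)) => t; rewrite ?fE.
    by rewrite -F12 c1E mx0 scale1r.
  by rewrite -F21 c2E mx0 scale1r.
by move=> h t Hh; rewrite !fE e21// F12 -e22// !c2E mx0 !scale1r.
Qed.

End RepresentationTheory.

(** * The commutant of the Heisenberg representation *)

Lemma inhabited_compact_cover (T : topologicalType) (t : T) :
  @compact T = @cover_compact T.
Proof.
pose M := isPointed.Build T t.
exact: (@compact_cover (HB.pack_for ptopologicalType T M)).
Qed.

Section HeisenbergSchur.
Variables (F : topFieldType) (W : vectType F) (form : {skew_symmetric W}).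
Variables (X Y : {vspace W}) (psi : smooth_character F).
Hypothesis polXY : polarisation form X Y.

Local Notation YT := (vtop (subvs_of Y)).

Lemma ccinf_mul (T : topologicalType) (m : T -> algC) (f : ccinf T) :
  locally_constant m ->
  (fun y => m y * f y : algC^o) \in @ccinf_pred T.
Proof.
move=> mT; have /ccinfP[fT fK] := valP f; apply/ccinfP; split.
  exact: (locally_constant_op2 (fun s t => s * t) mT fT).
by apply: fsupport_compact fK => y ->; rewrite mulr0.
Qed.

Lemma pol_fst_id x : x \in X -> pol_fst X Y x = x.
Proof. by case: polXY => _ _ _ XY0; exact: daddv_pi_id. Qed.

Lemma pol_snd_X x : x \in X -> pol_snd X Y x = 0.
Proof.
case: polXY => _ _ XYW XY0 Xx; apply: val_inj.
have := daddv_pi_add XY0 (w := x); rewrite XYW memvf => /(_ isT).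
rewrite [daddv_pi X Y x]pol_fst_id// -[RHS]addr0 => /addrI yx0.
by rewrite /pol_snd yx0 linear0.
Qed.

Lemma pol_fst_Y (y : subvs_of Y) : pol_fst X Y (vsval y) = 0.
Proof.
case: polXY => _ _ XYW XY0.
have := daddv_pi_add XY0 (w := vsval y); rewrite XYW memvf => /(_ isT).
rewrite [daddv_pi Y X _]daddv_pi_id ?subvsP//; last by rewrite capvC.
by rewrite -[RHS]add0r => /addIr.
Qed.

Lemma pol_snd_Y (y : subvs_of Y) : pol_snd X Y (vsval y) = y.
Proof.
case: polXY => _ _ _ XY0; rewrite /pol_snd daddv_pi_id ?subvsP// 1?capvC//.
exact: vsvalK.
Qed.

Lemma heis_rep_X x (f : ccinf YT) (y : YT) : x \in X ->
  heis_rep form X psi (x, 0) f y = psi (form (vsval y) x) * f y.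
Proof.
move=> Xx; rewrite /= /heis_fun /= pol_fst_id// pol_snd_X// addr0.
by rewrite schar0 mul1r linear0l mulr0 addr0.
Qed.

Lemma heis_rep_Y (z : subvs_of Y) (f : ccinf YT) (y : YT) :
  heis_rep form X psi (vsval z, 0) f y = f (y + z).
Proof.
rewrite /= /heis_fun /= pol_fst_Y pol_snd_Y linear0r linear0r mulr0 addr0.
by rewrite schar0 !mul1r.
Qed.

(** As [X] is its own orthogonal and meets [Y] trivially, [y] pairs nontrivially with some x in [X].
    Rescaling x makes the pairing a point where [psi] is not 1. *)
Lemma character_separates (y : subvs_of Y) : y != 0 ->
  exists2 x, x \in X & psi (form (vsval y) x) != 1.
Proof.
case: polXY => XX _ _ XY0 y0.
have /(@mem_orthovPn _ _ _ _ form)[x Xx yx] : vsval y \notin orthov form X.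
  rewrite XX; apply: contra_neqN y0 => Xy; apply: val_inj => /=.
  by apply/eqP; rewrite -memv0 -XY0 memv_cap Xy subvsP.
have [t psit] := schar_nontrivial psi.
exists ((t / form (vsval y) x) *: x); first exact: memvZ.
by rewrite linearZr_LR /= mulfVK.
Qed.

Lemma character_continuous (x : W) :
  locally_constant (fun y : YT => psi (form (vsval y) x)).
Proof.
apply: (@locally_constant_comp YT F _ (fun y => form (vsval y) x) psi).
  exact: (@vtop_scalar_continuous F (subvs_of Y)
            (applyr form x \o vsval : {scalar subvs_of Y})).
exact: schar_smooth.
Qed.

Variable A : {linear ccinf YT -> ccinf YT}.
Hypothesis AC : forall h f,
  A (heis_rep form X psi h f) = heis_rep form X psi h (A f).

(* On its support f is a finite sum of products (character - 1) * g, each of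
   which A maps to a function vanishing at 0. *)
Lemma commutant_eval0_finite (s : seq W) (f : ccinf YT) :
  {in s, forall x, x \in X} ->
  (forall z : YT, f z != 0 -> exists2 x, x \in s & psi (form (vsval z) x) != 1) ->
  A f 0 = 0.
Proof.
elim: s f => [|x s IHs] f sX fs.
  have -> : f = 0.
    apply/val_inj/funext => z; apply/eqP/negPn/negP => fz.
    by have [] := fs z fz.
  by rewrite linear0.
have Xx : x \in X by apply: sX; rewrite mem_head.
pose m (z : YT) := psi (form (vsval z) x) - 1.
have mT : locally_constant (fun z => (m z)^-1).
  apply: (@locally_constant_op2 YT _ _ _ (fun z => psi (form (vsval z) x))
    (fun=> 1) (fun a b : algC => (a - b)^-1)).
    exact: character_continuous.
  exact: locally_constant_cst.
pose g := CcInf (ccinf_mul f mT).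
(* Since [0^-1 = 0], [f'] equals [f] where [m] vanishes and 0 elsewhere, so the remaining characters
   in [s] suffice on its support. *)
pose f' := f - (heis_rep form X psi (x, 0) g - g).
have f'E z : f' z = f z - m z * ((m z)^-1 * f z).
  have -> : f' z = f z - (heis_rep form X psi (x, 0) g z - g z) by [].
  by rewrite heis_rep_X// /m mulrBl mul1r.
have fE : f = f' + (heis_rep form X psi (x, 0) g - g) by rewrite subrK.
clearbody f'; rewrite [in LHS]fE linearD [A (_ - _)]linearB AC.
have -> : (A f' + (heis_rep form X psi (x, 0) (A g) - A g)) 0 =
   A f' 0 + (heis_rep form X psi (x, 0) (A g) 0 - A g 0) by [].
rewrite heis_rep_X// linear0 linear0l schar0 mul1r subrr addr0.
apply: IHs => [w ws|z]; first by apply: sX; rewrite inE ws orbT.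
rewrite f'E; have [mz|mz] := eqVneq (m z) 0.
  rewrite mz mul0r subr0 => /fs[w]; rewrite inE => /predU1P[-> psix|]; last by exists w.
  by move/eqP: mz; rewrite /m subr_eq0 (negPf psix).
by rewrite mulVKf// subrr eqxx.
Qed.

(** The support of [f] is compact and misses 0, so the open sets where some character from [X]
    differs from 1 cover it, and finitely many of them suffice. *)
Lemma commutant_eval0 (f : ccinf YT) : f 0 = 0 -> A f 0 = 0.
Proof.
move=> f0; have /ccinfP[fT] := valP f; rewrite (inhabited_compact_cover (0 : YT)).
pose U (x : W) : set YT := [set y | psi (form (vsval y) x) != 1].
have Uo x : [set x | x \in X] x -> open (U x).
  move=> _; rewrite (_ : U x = \bigcup_(a in [set a : algC | a != 1])
    ((fun y : YT => psi (form (vsval y) x)) @^-1` [set a])).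
    by apply: bigcup_open => a _; exact: character_continuous.
  apply/seteqP; split=> [y Uy|y [a a1 ya]]; first by exists (psi (form (vsval y) x)).
  by rewrite /U /= ya.
(* As [f] is locally constant, the set where it is nonzero is already closed. *)
have Kf : fsupport f `<=` [set y | f y != 0].
  rewrite /fsupport -(iffLR (closure_id _)) //.
  rewrite (_ : [set y | _] = ~` (f @^-1` [set 0])); first exact/open_closedC/fT.
  by apply/seteqP; split=> z /= /eqP.
move=> /(_ W [set x | x \in X] U Uo)[|D DX Dcover].
  move=> y /Kf fy; have [|x Xx yx] := @character_separates y.
    by apply: contra_neq fy => ->.
  by exists x.
apply: (commutant_eval0_finite (s := finmap.enum_fset D)) => [x xD|z fz].
  by have := DX _ xD; rewrite in_setE.
have [|x /= xD Uz] := Dcover z; first exact: subset_closure.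
by exists x.
Qed.

(** The value [A f 0] depends only on [f 0], hence is [r * f 0]. Translations by [Y] belong to the
    Heisenberg representation and carry this from 0 to every point. *)
Lemma heis_commutant_scalar : exists r : algC, forall f, A f = r *: f.
Proof.
have [r rE] : exists r : algC, forall f, A f 0 = r * f 0.
  have [[g g0]|no] := pselect (exists g : ccinf YT, g 0 != 0).
    exists (A g 0 / g 0) => f; pose k := f - (f 0 / g 0) *: g.
    have k0 : k 0 = 0.
      have -> : k 0 = f 0 - f 0 / g 0 * g 0 by [].
      by rewrite divfK// subrr.
    have := commutant_eval0 k0; rewrite /k linearB linearZ.
    have -> : (A f - (f 0 / g 0) *: A g) 0 = A f 0 - f 0 / g 0 * A g 0 by [].
    by move/subr0_eq => ->; rewrite [LHS]mulrC mulrA mulrAC.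
  exists 0 => f; rewrite mul0r; apply: commutant_eval0.
  by apply/eqP/negPn/negP => f0; apply: no; exists f.
exists r => f; apply/val_inj/funext => y.
have := rE (heis_rep form X psi (vsval (y : subvs_of Y), 0) f).
by rewrite AC !heis_rep_Y !add0r.
Qed.

End HeisenbergSchur.

(** * Transvections and uniqueness of the Weil representation *)

Section Transvections.
Variables (F : topFieldType) (W : vectType F) (form : {skew_symmetric W}).
Hypotheses (two_neq0 : 2%:R != 0 :> F) (form_symplectic : is_psymplectic form).

Lemma formC u v : form u v = - form v u.
Proof. by rewrite hermC /= expr1 mulN1r. Qed.

Lemma form_alternating u : form u u = 0.
Proof.
have /eqP := formC u u; rewrite -addr_eq0 -mulr2n -mulr_natl mulf_eq0.
by rewrite (negPf two_neq0) => /eqP.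
Qed.

Lemma form_nondegenerate u : u != 0 -> exists w, form u w != 0.
Proof.
move=> u0; have [/eqP rad0 _ _] := form_symplectic.
have /(@mem_orthovPn _ _ _ _ form)[w _ uw] : u \notin orthov form fullv.
  by rewrite rad0 memv0.
by exists w.
Qed.

Definition transvection_fun (u : W) (a : F) (w : W) : W := w + (a * form w u) *: u.

Lemma transvection_fun_linear u a : linear (transvection_fun u a).
Proof.
move=> b v w; rewrite /transvection_fun linearPl /= mulrDr mulrCA scalerDl.
by rewrite scalerDr scalerA addrACA.
Qed.

HB.instance Definition _ u a :=
  GRing.isLinear.Build F W W *:%R (transvection_fun u a)
    (transvection_fun_linear u a).

Definition transvection u a : 'End(W) := linfun (transvection_fun u a).

Lemma transvectionE u a w : transvection u a w = w + (a * form w u) *: u.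
Proof. by rewrite lfunE. Qed.

Lemma Sp_transvection u a : Sp form (transvection u a).
Proof.
move=> v w; rewrite !transvectionE linearDl !linearDr /= !linearZl_LR !linearZr_LR /=.
by rewrite form_alternating (formC u w); ring.
Qed.

Lemma Sp_comp g h : Sp form g -> Sp form h -> Sp form (g \o h)%VF.
Proof. by move=> gS hS v w; rewrite !comp_lfunE gS hS. Qed.

(** The form is alternating, so [form u (v - u) = form u v]; this fixes the constant. *)
Lemma transvection_to u v : form u v != 0 ->
  transvection (v - u) (form u v)^-1 u = v.
Proof.
move=> uv0; rewrite transvectionE linearBr /= form_alternating subr0.
by rewrite mulVf// scale1r addrC subrK.
Qed.

Lemma transvection_conj k u a w : Sp form k ->
  k (transvection u a w) = transvection (k u) a (k w).
Proof. by move=> kS; rewrite !transvectionE linearD linearZ /= kS. Qed.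

Local Notation fix_space g := (lker (g - \1%VF)).

Lemma fix_spaceP (g : 'End(W)) w : reflect (g w = w) (w \in fix_space g).
Proof.
rewrite memv_ker add_lfunE opp_lfunE id_lfunE subr_eq0; exact: eqP.
Qed.

(** A vector v fixed by [g] satisfies [form v (g z) = form (g v) (g z) = form v z], so it is
    orthogonal to [z - g z]. *)
Lemma fix_space_transvection g z a : Sp form g ->
  (fix_space g <= fix_space (transvection (z - g z) a \o g)%VF)%VS.
Proof.
move=> gS; apply/subvP => v /fix_spaceP gv; apply/fix_spaceP.
have vz : form v (g z) = form v z by rewrite -{1}gv gS.
by rewrite comp_lfunE gv transvectionE linearBr /= vz subrr mulr0 scale0r addr0.
Qed.

(* Multiplying g by the transvection along w - g w enlarges the fixed space as
   soon as <g w, w> != 0. If <g w, w> = 0 for all w, one transvection along a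
   vector z - g z brings us to that case without shrinking the fixed space. *)
Lemma Sp_transvection_ind (S : 'End(W) -> Prop) :
  S \1%VF ->
  (forall g u a, Sp form g -> S (transvection u a \o g)%VF -> S g) ->
  forall g, Sp form g -> S g.
Proof.
(* Induction on the codimension of the fixed space. *)
move=> S1 ST g; have [n] := ubnP (\dim {:W} - \dim (fix_space g)).
elim: n g => // n IHn g gn gS.
have [gfull|gNfull] := eqVneq (fix_space g) fullv.
  suff -> : g = \1%VF by [].
  by apply/lfunP => w; rewrite id_lfunE; apply/fix_spaceP; rewrite gfull memvf.
have step h : Sp form h -> (fix_space g <= fix_space h)%VS ->
    (exists w, form (h w) w != 0) -> S h.
  move=> hS gh [w hw].
  (* [t] sends [h w] to [w], so [t \o h] fixes [w]. The map [h] does not, since otherwise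
     [form (h w) w] would be 0. *)
  pose t := transvection (w - h w) (form (h w) w)^-1.
  apply: (ST h (w - h w) (form (h w) w)^-1 hS); apply: IHn.
    have ht : (fix_space h <= fix_space (t \o h)%VF)%VS.
      exact: fix_space_transvection.
    have : (\dim (fix_space h) < \dim (fix_space (t \o h)%VF))%N.
      rewrite (ltn_leqif (dimv_leqif_sup ht)); apply/subvPn; exists w.
        by apply/fix_spaceP; rewrite comp_lfunE transvection_to.
      by apply: contra hw => /fix_spaceP ->; rewrite form_alternating.
    have := dimvS gh; have := dimvS (subvf (fix_space (t \o h)%VF)).
    rewrite -/t; lia.
  exact/Sp_comp/hS/Sp_transvection.
have [gw|gw] := pselect (exists w, form (g w) w != 0); first exact: step.
have {}gw w : form (g w) w = 0 by apply/eqP/negPn/negP => gw0; apply: gw; exists w.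
(* Polarising [form (g w) w = 0] shows that [g] is self-adjoint for the form. *)
have gC v w : form (g v) w = form v (g w).
  have := gw (v + w); rewrite [g _]linearD !linearDl !linearDr /= !gw add0r addr0.
  by move/eqP; rewrite addr_eq0 => /eqP ->; rewrite -formC.
have [z gz] : exists z, z - g z != 0.
  apply: contrapT => /forallNP gz; case/eqP: gNfull; apply/vspaceP => z.
  rewrite memvf; apply/fix_spaceP/esym/eqP; rewrite -subr_eq0.
  exact/negPn/negP/gz.
apply: (ST g (z - g z) 1 gS); apply: step.
- exact/Sp_comp/gS/Sp_transvection.
- exact: fix_space_transvection.
(* With [u = z - g z], the new map [h] satisfies [form (h w) w = (form u w)^2], because
   [form (g w) u = - form w u]. *)
have [w zw] := form_nondegenerate gz; exists w.
rewrite comp_lfunE transvectionE linearDl /= gw add0r linearZl_LR /= mul1r.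
have -> : form (g w) (z - g z) = - form w (z - g z).
  by rewrite !linearBr /= gS gC opprB.
by rewrite -formC mulf_neq0.
Qed.

End Transvections.

Section WeilUnique.
Variables (F : topFieldType) (W : vectType F) (form : {skew_symmetric W}).
Hypotheses (two_neq0 : 2%:R != 0 :> F) (form_symplectic : is_psymplectic form).
Variables (X Y : {vspace W}) (polXY : polarisation form X Y).
Variables (Mp : topGroupType) (p : Mp -> 'End(W)).
Hypothesis pM : forall g h, p (g * h)%g = (p g \o p h)%VF.
Hypothesis p1 : p 1%g = \1%VF.
Hypothesis p_range : range p = Sp form.

Local Notation V := (ccinf (vtop (subvs_of Y))).

Lemma cover_Sp g : Sp form (p g).
Proof. by rewrite -p_range; exists g. Qed.

Lemma cover_surj t : Sp form t -> exists g, p g = t.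
Proof. by rewrite -p_range => -[g _ <-]; exists g. Qed.

Lemma cover_invK g w : p g^-1%g (p g w) = w.
Proof. by rewrite -comp_lfunE -pM mulVg p1 id_lfunE. Qed.

Lemma cover_Kinv g w : p g (p g^-1%g w) = w.
Proof. by rewrite -comp_lfunE -pM mulgV p1 id_lfunE. Qed.

Lemma siegel_radical_transvection u a : u \in X ->
  siegel_radical form X (transvection form u a).
Proof.
have [XX _ _ _] := polXY.
move=> Xu; split; first exact: Sp_transvection.
  move=> x Xx; rewrite transvectionE.
  have /mem_orthovP/(_ _ Xu) -> : x \in orthov form X by rewrite XX.
  by rewrite mulr0 scale0r addr0.
by move=> w; rewrite transvectionE addrC addKr memvZ.
Qed.

(** The map [b = n - 1] has image in [X] and kills [X], so [b^2 = 0] and [(1 + b/2)^2 = 1 + b]. *)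
Lemma siegel_radical_half n : siegel_radical form X n ->
  exists2 m, siegel_radical form X m & n = (m \o m)%VF.
Proof.
have [XX _ _ _] := polXY.
have isoX x x' : x \in X -> x' \in X -> form x x' = 0.
  by move=> Xx Xx'; have /mem_orthovP/(_ _ Xx') : x \in orthov form X by rewrite XX.
move=> [nS nX nW]; pose m : 'End(W) := (\1 + 2%:R^-1 *: (n - \1))%VF.
have mE w : m w = w + 2%:R^-1 *: (n w - w).
  by rewrite !(add_lfunE, scale_lfunE, opp_lfunE, id_lfunE).
exists m.
  split=> [v w|x Xx|w].
  - have nE w' : n w' = w' + (n w' - w') by rewrite addrC subrK.
    have := nS v w; rewrite (nE v) (nE w) !mE.
    have := nW v; have := nW w; move: (n v - v) (n w - w) => a b Xb Xa.
    rewrite !linearDl !linearDr /= !linearZl_LR !linearZr_LR /= (isoX a b)// => e.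
    have {}e : form v b + form a w = 0.
      by apply: (@addrI _ (form v w)); rewrite addrA addr0 -[RHS]e addr0.
    move/eqP: e; rewrite addr_eq0 => /eqP ->; ring.
  - by rewrite mE nX// subrr scaler0 addr0.
  - by rewrite mE addrC addKr memvZ.
apply/lfunP => w; rewrite comp_lfunE mE.
have -> : n (m w) - m w = n w - w.
  rewrite mE linearD linearZ /= (nX _ (nW w)) opprD addrACA subrr.
  by rewrite addr0.
rewrite mE -addrA -scalerDl -[X in X + X]mul1r -mulrDl mulfV// scale1r.
by rewrite addrC subrK.
Qed.

Lemma is_rep_linear (G : topGroupType) (H : set G) (U : lmodType algC)
    (act : G -> U -> U) g :
  is_rep H act -> H g -> exists f : {linear U -> U}, forall v, f v = act g v.
Proof. by case=> lin _ _ Hg; exact: linear_exists (lin g Hg). Qed.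

Lemma weil_actK (psi : smooth_character F) (om : Mp -> V -> V) :
  weil_rep form X p psi om ->
  forall g f, om g^-1%g (om g f) = f.
Proof.
by case=> -[_ om1 omM] _ _ _ _ g f; rewrite -omM// mulVg om1.
Qed.

Variable psi : smooth_character F.
Variables om1 om2 : Mp -> V -> V.
Hypothesis om1W : weil_rep form X p psi om1.
Hypothesis om2W : weil_rep form X p psi om2.

(** The operator [om2 g^-1 \o om1 g] commutes with the Heisenberg representation. *)
Lemma weil_scalar g : exists r, forall f, om1 g f = r *: om2 g f.
Proof.
have [a aE] := is_rep_linear (weil_is_rep om1W) (I : setT g).
have [b bE] := is_rep_linear (weil_is_rep om2W) (I : setT g^-1%g).
have [c cE] := is_rep_linear (weil_is_rep om2W) (I : setT g).
have [A AE] : exists A : {linear V -> V}, forall f, A f = b (a f).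
  by exists (b \o a).
have [h f|r rE] := @heis_commutant_scalar _ _ form _ _ psi polXY A.
  rewrite !AE !aE !bE.
  have -> : om1 g (heis_rep form X psi h f) =
            heis_rep form X psi (heis_act (p g) h) (om1 g f).
    by rewrite -(weil_heis om1W) (weil_actK om1W).
  have hE : h = heis_act (p g^-1%g) (heis_act (p g) h).
    by case: h => w t; rewrite /heis_act /= cover_invK.
  by rewrite [in RHS]hE -[RHS](weil_heis om2W) (weil_actK om2W).
exists r => f; rewrite -cE -linearZ /= -rE AE aE bE cE.
by have := weil_actK om2W g^-1%g; rewrite invgK => ->.
Qed.

Local Notation agree g := (forall f, om1 g f = om2 g f).

Lemma agreeM g h : agree g -> agree h -> agree (g * h)%g.
Proof.
case: om1W om2W => -[_ _ omM] _ _ _ _ [[_ _ om2M]] _ _ _ _ ag ah f.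
by rewrite omM// om2M// ah ag.
Qed.

Lemma agreeV g : agree g -> agree g^-1%g.
Proof.
move=> ag f; rewrite -[in RHS](weil_actK om1W g^-1%g f) invgK ag.
by rewrite (weil_actK om2W).
Qed.

Lemma agree_kernel e : p e = \1%VF -> agree e.
Proof.
move=> pe f; have [->|e1] := eqVneq e 1%g.
  by case: om1W om2W => -[_ om11 _] _ _ _ _ [[_ om21 _]] _ _ _ _; rewrite om11 om21.
by rewrite (weil_kernel om1W)// (weil_kernel om2W).
Qed.

Lemma agree_fiber g h : p g = p h -> agree g -> agree h.
Proof.
move=> gh ag; rewrite -[h](mulgVK g); apply: agreeM => //; apply: agree_kernel.
by apply/lfunP => w; rewrite pM comp_lfunE -gh cover_Kinv id_lfunE.
Qed.

(** The scalars by which [om1] and [om2] differ at [k] and at [k^-1] cancel in a conjugation. *)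
Lemma agreeJ k n : agree (k * n * k^-1)%g -> agree n.
Proof.
move=> agk f.
have [r rE] := weil_scalar k; have [r' r'E] := weil_scalar k^-1%g.
have [b bE] := is_rep_linear (weil_is_rep om2W) (I : setT k^-1%g).
have rr (f' : V) : r' *: (r *: f') = f'.
  rewrite -[RHS](weil_actK om1W k) r'E rE -bE [b _]linearZ /= bE.
  by rewrite (weil_actK om2W).
have -> : n = (k^-1 * (k * n * k^-1) * k)%g by rewrite !mulgA mulVg mul1g mulgVK.
move: (k * n * k^-1)%g agk => j agj.
case: (om1W) (om2W) => -[_ _ om1M] _ _ _ _ [[_ _ om2M]] _ _ _ _.
have [c cE] := is_rep_linear (weil_is_rep om2W) (I : setT j).
rewrite om1M// om1M// om2M// om2M// agj r'E rE.
by rewrite -!cE [c (_ *: _)]linearZ /= -!bE [b (_ *: _)]linearZ /= rr.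
Qed.

(* The lifts of N(X) attached to two Weil representations are a priori
   different; as elements of N(X) are squares, the sign is harmless. *)
Lemma agree_siegel g : siegel_radical form X (p g) -> agree g.
Proof.
move=> nX; have [n gn] : exists n, n = p g by exists (p g).
rewrite -gn in nX; have [m mX nE] := siegel_radical_half nX.
have [s1 [ps1 s1M s1E]] := weil_siegel om1W.
have [s2 [ps2 s2M s2E]] := weil_siegel om2W.
apply: (@agree_fiber (s1 n)); first by rewrite ps1.
move=> f; transitivity (om2 (s2 n) f).
  by apply/val_inj/funext => y; rewrite /= s1E// s2E.
rewrite nE s1M// s2M//; case: (om2W) => -[_ _ omM] _ ker _ _; rewrite !omM//.
have sm : s1 m = (s1 m * (s2 m)^-1 * s2 m)%g by rewrite mulgVK.
have pe : p (s1 m * (s2 m)^-1)%g = \1%VF.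
  apply/lfunP => w; rewrite pM comp_lfunE ps1// -{1}(ps2 m mX).
  by rewrite cover_Kinv id_lfunE.
have [e1|e1] := eqVneq (s1 m * (s2 m)^-1)%g 1%g; first by rewrite sm e1 mul1g.
have smE f' : om2 (s1 m) f' = - om2 (s2 m) f' by rewrite sm omM// ker.
have [a aE] := is_rep_linear (weil_is_rep om2W) (I : setT (s2 m)).
by rewrite !smE -!aE linearN opprK.
Qed.

(** Conjugation by a symplectic [k] with [k u] in [X] moves the transvection into N(X). If [u] is
    orthogonal to [X] it already lies in [X]; otherwise a transvection takes it to some x in [X]
    with [form u x] nonzero. *)
Lemma agree_transvection g u a : p g = transvection form u a -> agree g.
Proof.
move=> gE; suff [k [kS Xku]] : exists k, Sp form k /\ k u \in X.
  have [h hk] := cover_surj kS; apply: (@agreeJ h); apply: agree_siegel.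
  suff -> : p (h * g * h^-1)%g = transvection form (k u) a.
    exact: siegel_radical_transvection.
  apply/lfunP => w; rewrite !pM !comp_lfunE gE -hk.
  by rewrite transvection_conj ?cover_Kinv//; exact: cover_Sp.
have [Xu|/(@mem_orthovPn _ _ _ _ form)[x Xx ux]] := boolP (u \in orthov form X).
  exists \1%VF; rewrite id_lfunE; split=> [v w|]; first by rewrite !id_lfunE.
  by have [<- _ _ _] := polXY.
exists (transvection form (x - u) (form u x)^-1); split.
  exact: Sp_transvection.
by rewrite transvection_to.
Qed.

Lemma weil_rep_unique g f : om1 g f = om2 g f.
Proof.
suff: forall t, Sp form t -> forall g f, p g = t -> om1 g f = om2 g f.
  by move/(_ _ (cover_Sp g) g f erefl).
move=> {g f}.
(* The property covers all lifts of [t] at once, so any lift of a transvection may be used in the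
   inductive step. *)
apply: (@Sp_transvection_ind _ _ form two_neq0 form_symplectic
          (fun t => forall g f, p g = t -> om1 g f = om2 g f)).
  by move=> g f /agree_kernel.
move=> t u a tS IH g f gt.
have [h hE] := cover_surj (@Sp_transvection _ _ form two_neq0 u a).
have ahg : agree (h * g)%g by move=> f'; apply: IH; rewrite pM hE gt.
have ah := agree_transvection hE.
by rewrite -[g](mulKg h); apply: (agreeM (agreeV ah) ahg).
Qed.

End WeilUnique.

(** * Galois twists *)

Section Twist.
Import VectorInternalTheory.
Variables (F : topFieldType) (U : vectType F) (sigma : {rmorphism algC -> algC}).

Lemma vtop_scale_continuous (c : F) :
  continuous (fun y : vtop U => (c *: y : vtop U)).
Proof.
apply/continuousP => _ [B Bopen <-]; rewrite openE => y /= By.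
have [P nP PB] : nbhs (v2r (c *: y) : 'rV[F]_(dim U)) B by exact: open_nbhs_nbhs.
have cC : continuous (fun t : F => c * t).
  move=> t; apply: (@continuous2_cvg _ _ _ _ _ _ _ _ (fun x y : F => x * y));
    last exact: cvg_id; last exact: cvg_cst.
  exact: (@mulf_continuous F (c, t)).
have nQ : nbhs (v2r y : 'rV[F]_(dim U))
    [set M | forall i j, ((fun t : F => c * t) @^-1` P i j) (M i j)].
  exists (fun i j => (fun t : F => c * t) @^-1` P i j) => // i j.
  by apply: cC; have := nP i j; rewrite linearZ mxE.
have cv := @initial_continuous U _ (v2r : U -> 'rV[F]_(dim U)) y.
apply: (@filterS _ (nbhs y) _ _ _ _ (cv _ nQ)) => z /= Qz.
by apply: PB => i j; rewrite linearZ mxE; exact: Qz.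
Qed.

Variables (c : F) (c0 : c != 0).

(** Scaling by [c] is a homeomorphism and [sigma] is injective on values, so local constancy and
    compact support persist. *)
Lemma twist_ccinf (f : ccinf (vtop U)) :
  (fun y : vtop U => sigma (f (c *: y)) : algC^o) \in @ccinf_pred (vtop U).
Proof.
have /ccinfP[fT fK] := valP f; apply/ccinfP; split=> [a|].
  have := locally_constant_comp (@vtop_scale_continuous c) fT.
  move=> /(_ (algC_invaut sigma a)); congr open; apply/seteqP.
  by split=> y /=; [move->; rewrite algC_invautK|move<-; rewrite algC_autK].
have cK : compact ((fun y : vtop U => c *: y) @^-1` fsupport f).
  have -> : (fun y : vtop U => c *: y) @^-1` fsupport f =
      (fun y : vtop U => c^-1 *: y) @` fsupport f.
    apply/seteqP; split=> z /=; first by exists (c *: z); rewrite ?scalerK.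
    by case=> z' fz' <-; rewrite scalerKV.
  apply: continuous_compact fK.
  by apply: continuous_subspaceT; exact: vtop_scale_continuous.
apply: (subclosed_compact _ cK); first exact: closed_closure.
have /closure_id -> : closed ((fun y : vtop U => c *: y) @^-1` fsupport f).
  have /continuous_closedP := @vtop_scale_continuous c; apply; exact: closed_closure.
apply: closureS => z /= nz; apply: subset_closure => /=.
by apply: contra_neq nz => ->; rewrite rmorph0.
Qed.

Definition twist (f : ccinf (vtop U)) : ccinf (vtop U) := CcInf (twist_ccinf f).

Lemma twist_semilinear a f g : twist (a *: f + g) = sigma a *: twist f + twist g.
Proof.
apply/val_inj/funext => y.
by rewrite -[LHS]/(sigma (a * f (c *: y) + g (c *: y))) rmorphD rmorphM.
Qed.

End Twist.

Lemma twistK (F : topFieldType) (U : vectType F) (sigma tau : {rmorphism algC -> algC})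
    (c d : F) (c0 : c != 0) (d0 : d != 0) :
  cancel sigma tau -> c * d = 1 ->
  cancel (@twist F U sigma c c0) (@twist F U tau d d0).
Proof.
move=> st cd f; apply/val_inj/funext => y /=.
by rewrite st scalerA cd scale1r.
Qed.

Section WeilTwist.
Variables (F : topFieldType) (W : vectType F) (form : {skew_symmetric W}).
Variables (X Y : {vspace W}) (Mp : topGroupType) (p : Mp -> 'End(W)).
Variables (sigma : {rmorphism algC -> algC}) (c : F) (c0 : c != 0).
Variables (psi psi' : smooth_character F).
Hypothesis psi'E : forall t, psi' t = sigma (psi (c ^+ 2 * t)).

Local Notation V := (ccinf (vtop (subvs_of Y))).

Let c'0 : c^-1 != 0. Proof. by rewrite invr_eq0. Qed.

Definition twistV : V -> V := twist sigma c0.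
Definition untwistV : V -> V := twist (algC_invaut sigma) c'0.

Lemma twistVK : cancel twistV untwistV.
Proof. by apply: twistK (@algC_autK sigma) _; rewrite divff. Qed.

Lemma untwistVK : cancel untwistV twistV.
Proof. by apply: twistK (@algC_invautK sigma) _; rewrite mulVf. Qed.

(** The map [(w, t) |-> (c w, c^2 t)] is an automorphism of the Heisenberg group, since the form is
    quadratic in the scaling. *)
Lemma twist_heis h f :
  twistV (heis_rep form X psi (c *: h.1, c ^+ 2 * h.2) f) =
  heis_rep form X psi' h (twistV f).
Proof.
apply/val_inj/funext => y.
rewrite /= /heis_fun /= !psi'E !rmorphM.
have -> : pol_fst X Y (c *: h.1) = c *: pol_fst X Y h.1 by rewrite /pol_fst linearZ.
have -> : pol_snd X Y (c *: h.1) = c *: pol_snd X Y h.1 by rewrite /pol_snd !linearZ.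
rewrite -scalerDr; congr (_ * sigma (psi _) * _).
have vZ (z : subvs_of Y) : vsval (c *: z) = c *: vsval z by rewrite linearZ.
rewrite !vZ !linearZl_LR !linearZr_LR /=; ring.
Qed.

(** Conjugating by a semilinear bijection keeps the operators linear, as [sigma] and its inverse
    cancel. The scaling of the Heisenberg group commutes with the action of Sp(W). *)
Lemma twist_weil_rep (om : Mp -> V -> V) :
  weil_rep form X p psi om ->
  weil_rep form X p psi' (fun g f => twistV (om g (untwistV f))).
Proof.
case=> -[omL om1 omM] sm ker heis [s [ps sM sE]].
have twistN f : twistV (- f) = - twistV f.
  by apply/val_inj/funext => y; exact: (rmorphN sigma (f (c *: y))).
split.
- split=> [g _ a f f'|f|g h f _ _].
  + by rewrite /untwistV twist_semilinear omL// /twistV twist_semilinear algC_invautK.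
  + by rewrite om1 untwistVK.
  + by rewrite twistVK omM.
- move=> f; have := sm (untwistV f); congr (open (_ : set (subspace _))).
  apply/seteqP; split=> h /= [_ hf]; split => //; first by rewrite hf untwistVK.
  by rewrite -{2}hf twistVK.
- by move=> e f pe e1; rewrite ker// twistN untwistVK.
- move=> g h f; rewrite -[heis_rep form X psi' h _]twist_heis twistVK heis.
  by rewrite /heis_act /= linearZ /= (twist_heis (p g h.1, h.2)) untwistVK.
(* The same lift of N(X) serves: the phase is quadratic in [y], so scaling by [c] contributes
   exactly the [c ^+ 2] of [psi'E]. *)
- exists s; split=> // n f y nX.
  rewrite /= sE// rmorphM /= psi'E algC_invautK scalerA mulVf// scale1r.
  congr (sigma (psi _) * _).
  rewrite [n _]linearZ /= -scalerBr.
  by rewrite linearZl_LR linearZr_LR /=; ring.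
Qed.

End WeilTwist.

Lemma cover_unit (F : topFieldType) (W : vectType F) (form : {skew_symmetric W})
    (Mp : topGroupType) (p : Mp -> 'End(W)) :
  double_cover form p -> p 1%g = \1%VF.
Proof. by case=> _ _ _ _ [e _ /seteqP[_ /(_ 1%g)]]; apply; left. Qed.

Section GaloisTensor.
Variable sigma : {rmorphism algC -> algC}.

Lemma algC_invaut_invol (tau : {rmorphism algC -> algC}) a :
  tau =1 algC_invaut sigma -> algC_invaut tau a = sigma a.
Proof. by move=> tauE; rewrite -[in RHS](algC_invautK tau a) tauE algC_invautK. Qed.

Lemma galois_scaleE (U : lmodType algC) a (u : U) :
  (sigma a *: (u : galois_space sigma U)) = a *: u.
Proof. by rewrite -[LHS]/(algC_invaut sigma (sigma a) *: u) algC_autK. Qed.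

(** A bilinear map from the twisted spaces to [Z] is bilinear from the original ones to [Z] twisted
    by the inverse of [sigma]; the universal property of [tau] applies there and is carried back
    along [e']. *)
Lemma semilinear_tensor_product (U1 U2 T T' : lmodType algC)
    (tau : {bilinear U1 -> U2 -> T})
    (tau' : {bilinear galois_space sigma U1 -> galois_space sigma U2 -> T'})
    (e : T -> T') (e' : T' -> T) :
  cancel e e' -> cancel e' e ->
  (forall a u v, e (a *: u + v) = sigma a *: e u + e v) ->
  (forall u v, tau' u v = e (tau u v)) ->
  is_tensor_product tau -> is_tensor_product tau'.
Proof.
move=> eK e'K eL tau'E tauT Z beta.
pose rho : {rmorphism algC -> algC} := algC_invaut sigma.
pose Zr : lmodType algC := galois_space rho Z.
have ZrE a (z : Z) : (a *: (z : Zr) : Z) = sigma a *: z.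
  by rewrite -[LHS]/(algC_invaut rho a *: z) algC_invaut_invol.
have [| |b bE] := @bilinear_exists _ U1 U2 Zr (fun u v => beta u v).
- by move=> v a x y; rewrite ZrE -linearPl /= galois_scaleE.
- by move=> u a x y; rewrite ZrE -linearPr /= galois_scaleE.
have [f fE fU] := tauT Zr b.
have e'L : forall a u v, e' (a *: u + v) = rho a *: e' u + e' v.
  move=> a u v; apply: (can_inj eK).
  by rewrite e'K eL !e'K algC_invautK.
have [|g gE] := @linear_exists _ T' Z (fun z => f (e' z)).
  by move=> a x y; rewrite e'L linearP ZrE algC_invautK.
exists g => [u v|h hE z]; first by rewrite gE tau'E eK fE bE.
have [|k kE] := @linear_exists _ T Zr (fun z => h (e z)).
  by move=> a x y; rewrite eL linearP ZrE.
rewrite gE -(fU k) ?kE ?e'K// => u v.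
by rewrite kE -tau'E hE bE.
Qed.

Lemma galois_schur (G : topGroupType) (H : set G) (pi : rep H) :
  (forall A : {linear pi -> pi},
     intertwines H (@rep_act G H pi) (@rep_act G H pi) A ->
     exists r : algC, forall v, A v = r *: v) ->
  forall A : {linear galois_rep sigma pi -> galois_rep sigma pi},
     intertwines H (@rep_act G H (galois_rep sigma pi))
       (@rep_act G H (galois_rep sigma pi)) A ->
     exists r : algC, forall v, A v = r *: v.
Proof.
move=> endo A AH.
have [|B BE] := @linear_exists _ pi pi (fun v => A v).
  move=> a u v; rewrite -(galois_scaleE a u) -(galois_scaleE a (A u : pi)).
  exact: linearP.
have [h u Hh|r rE] := endo B; first by rewrite !BE; exact: AH.
by exists (sigma r) => v; rewrite galois_scaleE -rE BE.
Qed.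

End GaloisTensor.

(** * Theta lifts *)

(** Each member of a dual pair is the centraliser of the other, so this makes its preimage a
    subgroup, as Schur's lemma requires. *)
Lemma centraliser_subgroup (F : topFieldType) (W : vectType F)
    (form : {skew_symmetric W}) (Mp : topGroupType) (p : Mp -> 'End(W))
    (G : set 'End(W)) :
  double_cover form p -> is_subgroup (p @^-1` centraliser form G).
Proof.
move=> cov; have p1 := cover_unit cov; have [_ [pM pr] _ _ _] := cov.
split=> [|g h [gS gC] [hS hC]|g [gS gC]].
- split=> [v w|h _]; first by rewrite p1 !id_lfunE.
  by rewrite p1 comp_lfun1l comp_lfun1r.
- split; first exact: (cover_Sp pr).
  by move=> k Gk; rewrite pM -comp_lfunA hC// comp_lfunA gC// comp_lfunA.
- split; first exact: (cover_Sp pr).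
  move=> k Gk; apply/lfunP => w; rewrite !comp_lfunE.
  rewrite -[in LHS](cover_Kinv pM p1 g w).
  have /lfunP/(_ (p g^-1%g w)) := gC k Gk.
  by rewrite !comp_lfunE => <-; rewrite cover_invK.
Qed.

Section ThetaTwist.
Variables (F : topFieldType) (W : vectType F) (Y : {vspace W}).
Variables (Mp : topGroupType) (H1 H2 : set Mp) (sigma : {rmorphism algC -> algC}).

Local Notation V := (ccinf (vtop (subvs_of Y))).

Variables (om om' : Mp -> V -> V) (S S' : V -> V).
Hypotheses (SK : cancel S S') (S'K : cancel S' S).
Hypothesis SL : forall a f g, S (a *: f + g) = sigma a *: S f + S g.
Hypothesis Som : forall g f, S (om g f) = om' g (S f).
Variables (pi1 : rep H1) (Q Q' : lmodType algC).
Variables (act1 act2 : Mp -> Q -> Q) (q : {linear V -> Q}).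
Variables (act1' act2' : Mp -> Q' -> Q') (q' : {linear V -> Q'}).
Hypothesis qP : largest_isotypic_quotient H2 om pi1 act1 act2 q.
Hypothesis q'P : largest_isotypic_quotient H2 om' (galois_rep sigma pi1) act1' act2' q'.

Lemma untwist_semilinear a f g : S' (a *: f + g) = algC_invaut sigma a *: S' f + S' g.
Proof. by apply: (can_inj SK); rewrite S'K SL !S'K algC_invautK. Qed.

Lemma untwist_intertwines g f : S' (om' g f) = om g (S' f).
Proof. by apply: (can_inj SK); rewrite S'K Som S'K. Qed.

(** Composition with [S] or [S'] matches the H1-maps from [om'] to the twist of [pi1] with those
    from [om] to [pi1]. *)
Lemma isotypic_kernel f : q f = 0 <-> q' (S f) = 0.
Proof.
have [_ qk _ _] := qP; have [_ q'k _ _] := q'P; rewrite qk q'k.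
split=> f0 phi phiH.
  have [|k kE] := @linear_exists _ V pi1 (fun g => phi (S g)).
    by move=> a g h; rewrite SL linearP /= galois_scaleE.
  rewrite -kE; apply: f0 => h g Hh.
  by rewrite !kE Som phiH.
have [|k kE] := @linear_exists _ V (galois_rep sigma pi1) (fun g => phi (S' g)).
  move=> a g h; rewrite untwist_semilinear linearP /=.
  by rewrite -{2}[a](algC_invautK sigma) galois_scaleE.
have := f0 k; rewrite kE SK; apply=> h g Hh.
by rewrite !kE untwist_intertwines phiH.
Qed.

Lemma isotypic_quotient_twist : exists (e : Q -> Q') (e' : Q' -> Q),
  [/\ cancel e e', cancel e' e, forall f, e (q f) = q' (S f)
    & forall a u v, e (a *: u + v) = sigma a *: e u + e v].
Proof.
have [qT _ _ _] := qP; have [q'T _ _ _] := q'P.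
have surj (T : lmodType algC) (g : V -> T) : range g = setT ->
    exists r : T -> V, cancel r g.
  move=> gT; have /choice[r rE] : forall z, exists f, g f = z.
    by move=> z; have : setT z by []; rewrite -gT => -[f _ <-]; exists f.
  by exists r.
have [r rK] := surj _ _ qT; have [r' r'K] := surj _ _ q'T.
(* [r] and [r'] are mere set-theoretic sections; by [qE] the maps induced on the quotients do not
   depend on them. *)
pose e z := q' (S (r z)); pose e' z := q (S' (r' z)).
have SB f g : S (f - g) = S f - S g.
  by rewrite -[f - g]addrC -scaleN1r SL rmorphN1 scaleN1r addrC.
have qE f g : q f = q g <-> q' (S f) = q' (S g).
  have := isotypic_kernel (f - g); rewrite SB !linearB => -[to from].
  by split=> fg; apply: subr0_eq; [apply: to|apply: from]; rewrite fg subrr.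
have eE f : e (q f) = q' (S f) by apply/qE; rewrite rK.
have eK : cancel e e' by move=> z; rewrite -[RHS]rK; apply/qE; rewrite S'K r'K.
have e'K : cancel e' e by move=> z; rewrite eE S'K r'K.
exists e, e'; split=> // a u v.
by rewrite -(rK u) -(rK v) -linearP !eE SL linearP.
Qed.

(** Transporting [tau] along [e] presents [Q'] as the tensor product of the twist of [Theta] with
    that of [pi1]. It is also the one of [Theta'] with the latter, so the first factors agree. *)
Lemma theta_twist_iso (Theta Theta' : rep H2)
    (tau : {bilinear Theta -> pi1 -> Q})
    (tau' : {bilinear Theta' -> galois_rep sigma pi1 -> Q'}) :
  (exists v : pi1, v != 0) ->
  (forall A : {linear pi1 -> pi1},
     intertwines H1 (@rep_act Mp H1 pi1) (@rep_act Mp H1 pi1) A ->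
     exists r : algC, forall v, A v = r *: v) ->
  is_rep setT om' ->
  is_tensor_product tau -> is_tensor_product tau' ->
  (forall h t x, H1 h -> tau t (rep_act h x) = act1 h (tau t x)) ->
  (forall h t x, H2 h -> tau (rep_act h t) x = act2 h (tau t x)) ->
  (forall h t x, H1 h -> tau' t (rep_act h x) = act1' h (tau' t x)) ->
  (forall h t x, H2 h -> tau' (rep_act h t) x = act2' h (tau' t x)) ->
  rep_iso (galois_rep sigma Theta) Theta'.
Proof.
move=> pi0 endo om'R tauT tau'T t1 t2 t1' t2'.
have [e [e' [eK e'K eE eL]]] := isotypic_quotient_twist.
have [qT _ q1 q2] := qP; have [q'T _ q'1 q'2] := q'P.
have [| |te teE] := @bilinear_exists _ (galois_rep sigma Theta)
    (galois_rep sigma pi1) Q' (fun t x => e (tau t x)).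
- move=> x a t u.
  by rewrite -[LHS]/(e (tau (algC_invaut sigma a *: (t : Theta) + u) x)) linearPl
    eL algC_invautK.
- move=> t a x y.
  by rewrite -[LHS]/(e (tau t (algC_invaut sigma a *: (x : pi1) + y))) linearPr
    eL algC_invautK.
have teT : is_tensor_product te := semilinear_tensor_product eK e'K eL teE tauT.
have q_surj z : exists f, q f = z.
  by have : setT z by []; rewrite -qT => -[f _ <-]; exists f.
have q'_surj z : exists f, q' f = z.
  by have : setT z by []; rewrite -q'T => -[f _ <-]; exists f.
apply: (@isotypic_factor_unique _ _ _ (galois_rep sigma pi1) _ _ Q' act1' act2'
          te tau') => //.
- exact: galois_schur.
(* Linearity of [act1'] on H1 is inherited from [om'] through the surjection [q']. *)
- have [om'L _ _] := om'R.
  move=> h Hh a u v; have [f <-] := q'_surj u; have [g <-] := q'_surj v.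
  by rewrite -linearP -!q'1// om'L// linearP.
- move=> h t x Hh; rewrite !teE -[LHS]/(e (tau t (rep_act h (x : pi1)))) t1//.
  by have [f <-] := q_surj (tau t x); rewrite -q1// !eE Som q'1.
- move=> h t x Hh; rewrite !teE -[LHS]/(e (tau (rep_act h (t : Theta)) x)) t2//.
  by have [f <-] := q_surj (tau t x); rewrite -q2// !eE Som q'2.
Qed.

End ThetaTwist.

Theorem theorem2
    (F : topFieldType) (Fchar : 2%:R != 0 :> F)
    (Ffl : finite_field F \/ nonarch_local_field F)
    (psi : smooth_character F)
    (W : vectType F) (form : {skew_symmetric W})
    (form_symplectic : is_psymplectic form) (W_nonzero : (0 < \dim {:W})%N)
    (X Y : {vspace W}) (XY_pol : polarisation form X Y)
    (Mp : topGroupType) (p : Mp -> 'End(W)) (p_mp : metaplectic_cover form p)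
    (G1 G2 : set 'End(W)) (G12 : reductive_dual_pair form G1 G2)
    (sigma : {rmorphism algC -> algC})
    (pi1 : rep (p @^-1` G1))
    (pi1_irr : irreducible pi1) (pi1_adm : admissible pi1)
    (Theta : rep (p @^-1` G2))
    (Theta_lift : is_theta_lift form X Y p (char_class psi) pi1 Theta)
    (Theta' : rep (p @^-1` G2))
    (Theta'_lift : is_theta_lift form X Y p (char_class (galois_char sigma psi))
                     (galois_rep sigma pi1) Theta') :
  rep_iso (galois_rep sigma Theta) Theta'.
Proof.
have [cov _ _] := p_mp; have [_ [pM p_range] _ _ _] := cov.
have p1 := cover_unit cov; have [_ G1E _ _] := G12.
have [_ [psi0 [om [[a a0 psi0E] om_weil]]]] := Theta_lift.
move=> [Q [act1 [act2 [q [tau [qP tauT t1 t2]]]]]].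
have [_ [psi0' [om' [[b b0 psi0'E] om'_weil]]]] := Theta'_lift.
move=> [Q' [act1' [act2' [q' [tau' [q'P tau'T t1' t2']]]]]].
have c0 : b / a != 0 by rewrite mulf_neq0 ?invr_eq0.
have psiE t : psi0' t = sigma (psi0 ((b / a) ^+ 2 * t)).
  rewrite psi0'E psi0E /=; congr (sigma (psi _)).
  by rewrite mulrA -exprMn [a * _]mulrC divfK.
have twist_weil := twist_weil_rep c0 psiE om_weil.
(* Uniqueness identifies [om'] with the conjugate of [om] by the twist. *)
have twist_om g f : twistV sigma c0 (om g f) = om' g (twistV sigma c0 f).
  rewrite -(weil_rep_unique Fchar form_symplectic XY_pol pM p1 p_range
    twist_weil om'_weil).
  by rewrite twistVK.
apply: (theta_twist_iso (@twistVK _ _ Y sigma _ c0) (@untwistVK _ _ Y sigma _ c0)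
  _ twist_om qP q'P _ _ (weil_is_rep om'_weil) tauT tau'T t1 t2 t1' t2').
- by move=> u f g; exact: twist_semilinear.
- by case: pi1_irr.
- move=> A; apply: schur pi1_irr pi1_adm.
  by rewrite -G1E; exact: centraliser_subgroup cov.
Qed.
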